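(* Let $X$ be a topological space, $X'\subset X$ an open set, and suppose that $X$ and $X'$ are paracompact. Let $\mathscr{S}$ be a sheaf of abelian groups on $X$. Then, for any fine resolution $0\to\mathscr{S}\to\mathscr{K}^{\bullet}$ of $\mathscr{S}$ on $X$ such that each $\mathscr{K}^{q}|_{X'}$ is fine, there is a canonical isomorphism $$H^{q}_{D_{\mathscr{K}}}(X,X')\simeq H^{q}(X,X';\mathscr{S})$$ for every $q$.
   Context: Sheaves are sheaves of abelian groups; complexes of sheaves $(\mathscr{K}^\bullet,d)$ satisfy $\mathscr{K}^q=0$ for $q<0$. A topological space is paracompact if it is Hausdorff and every open covering admits a locally finite refinement. A sheaf $\mathscr{G}$ on a paracompact space $X$ is soft if $\mathscr{G}(X)\to\mathscr{G}(S)$ is surjective for every closed $S\subset X$; it is fine if the sheaf $\mathscr{H}om(\mathscr{G},\mathscr{G})$ is soft. A fine resolution is a resolution by fine sheaves. The relative cohomology $H^q(X,X';\mathscr{S})$ is the $q$-th cohomology of the complex $\mathscr{F}^\bullet(X,X')$ of sections over $X$ that vanish on $X'$, where $0\to\mathscr{S}\to\mathscr{F}^\bullet$ is a flabby resolution (e.g. the Godement resolution). The relative cohomology for the sections of $\mathscr{K}^\bullet$, $H^q_{D_{\mathscr{K}}}(X,X')$, is the $q$-th cohomology of the complex with $q$-cochains the pairs $(\xi_1,\xi_{01})\in\mathscr{K}^q(X)\oplus\mathscr{K}^{q-1}(X')$ and differential $D(\xi_1,\xi_{01})=(d\xi_1,\ \xi_1|_{X'}-d\xi_{01})$. *)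

(* Defs.v *)
From HB Require Import structures.
From mathcomp Require Import all_boot all_order all_algebra.
From mathcomp Require Import generic_quotient.
From mathcomp Require Import all_classical topology.

Set Implicit Arguments.
Unset Strict Implicit.
Unset Printing Implicit Defensive.

Import GRing.Theory.
Local Open Scope classical_set_scope.
Local Open Scope ring_scope.
Local Open Scope quotient_scope.

(* "Refinement" means open refinement, as usual for paracompactness. *)
Definition paracompact (X : topologicalType) : Prop :=
  hausdorff_space X /\
  forall U : set (set X),
    (forall u, U u -> open u) -> \bigcup_(u in U) u = setT ->
    exists V : set (set X),
      [/\ forall v, V v -> open v,
          \bigcup_(v in V) v = setT,
          forall v, V v -> exists2 u, U u & v `<=` u
        & forall x : X, exists2 N : set X, nbhs x N &
            finite_set [set v | V v /\ N `&` v !=set0]].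

Record opens (X : topologicalType) := Opens {
  opens_set :> set X;
  opensP : open opens_set }.

Definition opensT (X : topologicalType) : opens X := Opens (@openT X).

Lemma subopensT (X : topologicalType) (U : opens X) : U `<=` opensT X.
Proof. by []. Qed.

Lemma opensI_subproof (X : topologicalType) (U V : opens X) :
  open ((U : set X) `&` V).
Proof. by apply: openI; exact: opensP. Qed.

Definition opensI (X : topologicalType) (U V : opens X) : opens X :=
  Opens (opensI_subproof U V).

Record presheaf (X : topologicalType) := Presheaf {
  sec :> opens X -> zmodType;
  res : forall U V : opens X, V `<=` U -> {additive sec U -> sec V};
  res_id : forall (U : opens X) (UU : U `<=` U) (s : sec U), res UU s = s;
  res_comp : forall (U V W : opens X) (VU : V `<=` U) (WV : W `<=` V)
    (WU : W `<=` U) (s : sec U), res WV (res VU s) = res WU s }.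

Arguments res {X} p {U V} VU : rename.

Definition is_sheaf (X : topologicalType) (F : presheaf X) : Prop :=
  forall (U : opens X) (I : Type) (V : I -> opens X)
    (VU : forall i, V i `<=` U), U `<=` \bigcup_i V i ->
  forall s : forall i, F (V i),
    (forall i j (W : opens X) (Wi : W `<=` V i) (Wj : W `<=` V j),
        res F Wi (s i) = res F Wj (s j)) ->
  exists! t : F U, forall i, res F (VU i) t = s i.

Record sheaf (X : topologicalType) := Sheaf {
  sheaf_presheaf :> presheaf X;
  sheafP : is_sheaf sheaf_presheaf }.

Lemma sheaf_ext (X : topologicalType) (F : presheaf X) (U : opens X)
    (I : Type) (V : I -> opens X) (VU : forall i, V i `<=` U) (s t : F U) :
  is_sheaf F -> U `<=` \bigcup_i V i ->
  (forall i, res F (VU i) s = res F (VU i) t) -> s = t.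
Proof.
move=> sF UV st.
have [|u [_ uP]] := sF U I V VU UV (fun i => res F (VU i) s).
  move=> i j W Wi Wj.
  by rewrite !(res_comp _ _ (subset_trans Wi (VU i))).
by rewrite -(uP s)// -(uP t).
Qed.

Record sheaf_hom (X : topologicalType) (F G : presheaf X) := SheafHom {
  hom_app :> forall U : opens X, {additive F U -> G U};
  hom_nat : forall (U V : opens X) (VU : V `<=` U) (s : F U),
    hom_app V (res F VU s) = res G VU (hom_app U s) }.

(* Exactness at G as sheaves, ker g = im f, where the sections of the image
   sheaf im f are those that are locally images of sections under f. *)
Definition sheaf_exact (X : topologicalType) (F G H : presheaf X)
    (f : sheaf_hom F G) (g : sheaf_hom G H) : Prop :=
  forall (U : opens X) (s : G U),
    g U s = 0 <->
    forall x, opens_set U x -> exists (V : opens X) (VU : V `<=` U),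
      opens_set V x /\ exists t : F V, f V t = res G VU s.

Definition flabby (X : topologicalType) (F : presheaf X) : Prop :=
  forall (U : opens X) (s : F U),
    exists t : F (opensT X), res F (@subopensT X U) t = s.

Section OpenRestriction.
Context (X : topologicalType) (X' : opens X).

Lemma open_of_sub_subproof (W : opens X') : open (set_val @` W : set X).
Proof.
case: W => W /= [B oB BW].
suff -> : set_val @` W = B `&` X' by apply: openI => //; exact: opensP.
apply/seteqP; split=> [_ [x Wx <-]|x [Bx X'x]].
  by split; [rewrite -BW in Wx; exact: Wx | exact: set_valP].
by exists (SigSub (mem_set X'x)) => //; rewrite -BW.
Qed.

Definition open_of_sub (W : opens X') : opens X :=
  Opens (open_of_sub_subproof W).

Lemma open_of_subS (V W : opens X') :
  W `<=` V -> open_of_sub W `<=` open_of_sub V.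
Proof. exact: image_subset. Qed.

Lemma sub_of_open_subproof (U : opens X) : open (set_val @^-1` U : set X').
Proof. by exists (U : set X) => //; exact: opensP. Qed.

Definition sub_of_open (U : opens X) : opens X' :=
  Opens (sub_of_open_subproof U).

Lemma sub_of_openK (V : opens X') (U : opens X) :
  U `<=` open_of_sub V -> U `<=` open_of_sub (sub_of_open U).
Proof. by move=> UV x Ux; have [y _ yx] := UV x Ux; exists y; rewrite //= yx. Qed.

Lemma sub_of_openS (V : opens X') (U : opens X) :
  U `<=` open_of_sub V -> sub_of_open U `<=` V.
Proof. by move=> UV x /UV[y Vy /val_inj <-]. Qed.

Context (F : sheaf X).

Definition presheaf_restr : presheaf X' :=
  @Presheaf X' (fun W => F (open_of_sub W))
    (fun V W (WV : W `<=` V) => res F (open_of_subS WV))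
    (fun W WW s => res_id _ s)
    (fun U V W VU WV WU s => res_comp _ _ _ s).

Lemma presheaf_restr_sheaf : is_sheaf presheaf_restr.
Proof.
move=> U I V VU UV s sV.
have [|i j W Wi Wj|t [tP tu]] := @sheafP X F (open_of_sub U) I
    (fun i => open_of_sub (V i)) (fun i => open_of_subS (VU i)) _ s.
- by move=> _ [x /UV[i _ Vix] <-]; exists i => //; exists x.
- have := sV i j (sub_of_open W) (sub_of_openS Wi) (sub_of_openS Wj).
  move=> /(congr1 (res F (sub_of_openK Wi))).
  by rewrite /= (res_comp _ _ Wi) (res_comp _ _ Wj).
- by exists t.
Qed.

Definition sheaf_restr : sheaf X' := Sheaf presheaf_restr_sheaf.

End OpenRestriction.

Section Stalk.
Context (X : topologicalType) (F : presheaf X) (x : X).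

Record local_section := LocalSection {
  ls_dom : opens X;
  ls_domx : opens_set ls_dom x;
  ls_sec : F ls_dom }.

HB.instance Definition _ := gen_eqMixin local_section.
HB.instance Definition _ := gen_choiceMixin local_section.

Definition same_germ (a b : local_section) : bool :=
  `[< exists (W : opens X) (Wa : W `<=` ls_dom a) (Wb : W `<=` ls_dom b),
      opens_set W x /\ res F Wa (ls_sec a) = res F Wb (ls_sec b) >].

Lemma same_germ_equiv : equiv_class_of same_germ.
Proof.
split=> [a|a b|b a c].
- by apply/asboolP; exists (ls_dom a), (@subset_refl _ _), (@subset_refl _ _);
    split=> //; exact: ls_domx.
- by apply/asboolP/asboolP => -[W [Wa [Wb [Wx e]]]]; exists W, Wb, Wa.
- move=> /asboolP[W [Wa [Wb [Wx e]]]] /asboolP[W' [Wb' [Wc [Wx' e']]]].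
  have sl : opensI W W' `<=` W by move=> y [].
  have sr : opensI W W' `<=` W' by move=> y [].
  apply/asboolP; exists (opensI W W'), (subset_trans sl Wa).
  exists (subset_trans sr Wc); split; first by split.
  rewrite -(res_comp Wa sl) -(res_comp Wc sr) e -e'.
  by rewrite !(res_comp _ _ (subset_trans sl Wb)).
Qed.

Canonical same_germ_equivRel := EquivRelPack same_germ_equiv.

Definition stalk := {eq_quot same_germ_equivRel}.

Definition germ (U : opens X) (Ux : opens_set U x) (s : F U) : stalk :=
  \pi_stalk (LocalSection Ux s).

End Stalk.

(* The set of sections over a subset A of X, i.e. the sections over A of the
   inverse image of F by the inclusion: the continuous sections over A of the
   sheaf space of F, whose topology is generated by the sets of germs of
   sections of F over opens of X. *)
Record sections_over (X : topologicalType) (F : presheaf X) (A : set X) :=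
  SectionsOver {
    so_val :> forall x : A, stalk F (val x);
    so_cont : forall x : A, exists (U : opens X) (t : F U), opens_set U (val x) /\
      forall (y : A) (Uy : opens_set U (val y)), so_val y = germ Uy t }.

Definition restr_over (X : topologicalType) (F : presheaf X) (A : set X)
    (t : F (opensT X)) : sections_over F A :=
  @SectionsOver X F A (fun x => @germ X F (val x) (opensT X) Logic.I t)
    (fun x => ex_intro _ (opensT X) (ex_intro _ t
       (conj Logic.I
         (fun y Uy => congr1 (fun p => @germ X F (val y) (opensT X) p t)
            (Prop_irrelevance Logic.I Uy))))).

Definition soft (X : topologicalType) (F : presheaf X) : Prop :=
  forall A : set X, closed A ->
    forall s : sections_over F A, exists t : F (opensT X), restr_over A t = s.

Section HomSheaf.
Context (X : topologicalType) (F G : presheaf X).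

(* Morphisms F|_U -> G|_U, the opens of U being the opens of X contained in U. *)
Record hom_on (U : opens X) := HomOn {
  ho_app : forall V : opens X, V `<=` U -> F V -> G V;
  ho_add : forall (V : opens X) (VU : V `<=` U) (s t : F V),
    ho_app VU (s + t) = ho_app VU s + ho_app VU t;
  ho_nat : forall (V W : opens X) (VU : V `<=` U) (WV : W `<=` V)
    (WU : W `<=` U) (s : F V),
    ho_app WU (res F WV s) = res G WV (ho_app VU s) }.

Lemma hom_on_eq (U : opens X) (f g : hom_on U) :
  (forall (V : opens X) (VU : V `<=` U) s, ho_app f VU s = ho_app g VU s) ->
  f = g.
Proof.
case: f g => [f fa fn] [g ga gn] /= fg.
have {}fg : f = g.
  apply: functional_extensionality_dep => V.
  by apply: functional_extensionality_dep => VU; apply/funext => s.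
by case: _ / fg ga gn => ga gn; congr HomOn; exact: Prop_irrelevance.
Qed.

Section Zmod.
Context (U : opens X).

HB.instance Definition _ := gen_eqMixin (hom_on U).
HB.instance Definition _ := gen_choiceMixin (hom_on U).

Program Definition ho_zero : hom_on U :=
  @HomOn U (fun V VU s => 0) _ _.
Next Obligation. by move=> *; rewrite /= addr0. Qed.
Next Obligation. by move=> *; rewrite /= raddf0. Qed.

Program Definition ho_opp (f : hom_on U) : hom_on U :=
  @HomOn U (fun V VU s => - ho_app f VU s) _ _.
Next Obligation. by move=> f *; rewrite /= ho_add opprD. Qed.
Next Obligation. by move=> f V W VU *; rewrite /= raddfN (ho_nat _ VU). Qed.

Program Definition ho_plus (f g : hom_on U) : hom_on U :=
  @HomOn U (fun V VU s => ho_app f VU s + ho_app g VU s) _ _.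
Next Obligation. by move=> f g *; rewrite /= !ho_add addrACA. Qed.
Next Obligation. by move=> f g V W VU *; rewrite /= raddfD !(ho_nat _ VU). Qed.

Lemma ho_plusA : associative ho_plus.
Proof. by move=> f g h; apply: hom_on_eq => V VU s /=; rewrite addrA. Qed.

Lemma ho_plusC : commutative ho_plus.
Proof. by move=> f g; apply: hom_on_eq => V VU s /=; rewrite addrC. Qed.

Lemma ho_plus0 : left_id ho_zero ho_plus.
Proof. by move=> f; apply: hom_on_eq => V VU s /=; rewrite add0r. Qed.

Lemma ho_plusN : left_inverse ho_zero ho_opp ho_plus.
Proof. by move=> f; apply: hom_on_eq => V VU s /=; rewrite addNr. Qed.

HB.instance Definition _ :=
  GRing.isZmodule.Build (hom_on U) ho_plusA ho_plusC ho_plus0 ho_plusN.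

End Zmod.

Section Res.
Context (U V : opens X) (VU : V `<=` U).

Definition ho_res (f : hom_on U) : hom_on V :=
  @HomOn V (fun W WV => ho_app f (subset_trans WV VU))
    (fun W WV => ho_add f (subset_trans WV VU))
    (fun W W' WV W'W W'V =>
       ho_nat f (subset_trans WV VU) W'W (subset_trans W'V VU)).

Lemma ho_res_additive : zmod_morphism ho_res.
Proof. by move=> f g; apply: hom_on_eq. Qed.

HB.instance Definition _ :=
  GRing.isZmodMorphism.Build (hom_on U) (hom_on V) ho_res ho_res_additive.

End Res.

Program Definition hom_presheaf : presheaf X :=
  @Presheaf X (fun U => hom_on U)
    (fun U V VU => ho_res VU : {additive hom_on U -> hom_on V}) _ _.
Next Obligation.
move=> U UU s; apply: hom_on_eq => V VU t /=.
by rewrite (Prop_irrelevance (subset_trans VU UU) VU).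
Qed.
Next Obligation.
move=> U V W VU WV WU s; apply: hom_on_eq => W' WW' t /=.
by congr (ho_app s _ t); exact: Prop_irrelevance.
Qed.

End HomSheaf.

Section HomSheafP.
Context (X : topologicalType) (F : presheaf X) (G : sheaf X).

Lemma hom_presheaf_sheaf : is_sheaf (hom_presheaf F G).
Proof.
move=> U I V VU UV f fP.
have Il W i : opensI W (V i) `<=` W by move=> x [].
have Ir W i : opensI W (V i) `<=` V i by move=> x [].
have cov (W : opens X) : W `<=` U -> W `<=` \bigcup_i opensI W (V i).
  by move=> WU x Wx; have [i _ Vx] := UV _ (WU _ Wx); exists i.
have fE i j (W : opens X) (Wi : W `<=` V i) (Wj : W `<=` V j) s :
    ho_app (f i) Wi s = ho_app (f j) Wj s.
  have /(congr1 (fun h => ho_app h (@subset_refl _ W) s)) /= := fP i j W Wi Wj.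
  by rewrite (Prop_irrelevance (subset_trans _ Wi) Wi)
             (Prop_irrelevance (subset_trans _ Wj) Wj).
have glue (W : opens X) (WU : W `<=` U) (s : F W) : exists! t : G W,
    forall i, res G (Il W i) t = ho_app (f i) (Ir W i) (res F (Il W i) s).
  apply: (@sheafP X G W I (fun i => opensI W (V i)) (Il W) (cov W WU)).
  move=> i j T Ti Tj.
  rewrite -(ho_nat (f i) (Ir W i) Ti (subset_trans Ti (Ir W i))).
  rewrite -(ho_nat (f j) (Ir W j) Tj (subset_trans Tj (Ir W j))).
  by rewrite !(res_comp _ _ (subset_trans Ti (Il W i))); exact: fE.
pose h (W : opens X) (WU : W `<=` U) (s : F W) : G W :=
  sval (cid (glue W WU s)).
have hP (W : opens X) (WU : W `<=` U) (s : F W) i :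
    res G (Il W i) (h W WU s) = ho_app (f i) (Ir W i) (res F (Il W i) s).
  by rewrite /h; case: cid => t [].
have ext (W : opens X) (WU : W `<=` U) (s t : G W) :
    (forall i, res G (Il W i) s = res G (Il W i) t) -> s = t.
  by move=> st; apply: (sheaf_ext (@sheafP X G) (cov W WU) st).
have hadd (W : opens X) (WU : W `<=` U) (s t : F W) :
    h W WU (s + t) = h W WU s + h W WU t.
  by apply: (ext W WU) => i; rewrite raddfD !hP raddfD ho_add.
have hnat (W T : opens X) (WU : W `<=` U) (TW : T `<=` W) (TU : T `<=` U)
    (s : F W) : h T TU (res F TW s) = res G TW (h W WU s).
  apply: (ext T TU) => i; rewrite hP.
  have TI : opensI T (V i) `<=` opensI W (V i) by move=> x [/TW].
  have IW : opensI T (V i) `<=` W by move=> x [/TW].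
  rewrite !(res_comp _ _ IW) -[res G IW _](res_comp (Il W i) TI) hP.
  by rewrite -(ho_nat _ _ _ (Ir T i)) (res_comp _ _ IW).
exists (HomOn hadd hnat); split=> [i|g gP].
  apply: hom_on_eq => W Wi s /=; apply: (ext W (subset_trans Wi (VU i))) => j.
  rewrite hP -(ho_nat (f i) Wi (Il W j) (subset_trans (Il W j) Wi)).
  exact: fE.
apply: hom_on_eq => W WU s /=; apply: (ext W WU) => i.
rewrite hP -(gP i) /= (ho_nat g WU); congr (res G _ _).
Qed.

Definition hom_sheaf : sheaf X := Sheaf hom_presheaf_sheaf.

End HomSheafP.

Definition fine (X : topologicalType) (G : sheaf X) : Prop :=
  soft (hom_sheaf G G).

(* Complexes vanish in negative degrees, hence the indexing by nat. *)
Record sheaf_complex (X : topologicalType) := SheafComplex {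
  sc_obj :> nat -> sheaf X;
  sc_d : forall q, sheaf_hom (sc_obj q) (sc_obj q.+1);
  sc_dd : forall q (U : opens X) (s : sc_obj q U),
    sc_d q.+1 U (sc_d q U s) = 0 }.

Record complex_hom (X : topologicalType) (K L : sheaf_complex X) :=
  ComplexHom {
    ch_app :> forall q, sheaf_hom (K q) (L q);
    ch_comm : forall q (U : opens X) (s : K q U),
      ch_app q.+1 U (sc_d K q U s) = sc_d L q U (ch_app q U s) }.

Definition is_resolution (X : topologicalType) (S : sheaf X)
    (K : sheaf_complex X) (iota : sheaf_hom S (K 0)) : Prop :=
  [/\ forall U : opens X, injective (iota U),
      sheaf_exact iota (sc_d K 0)
    & forall q, sheaf_exact (sc_d K q) (sc_d K q.+1)].

Definition resolution_hom (X : topologicalType) (S : sheaf X)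
    (K L : sheaf_complex X) (iK : sheaf_hom S (K 0)) (iL : sheaf_hom S (L 0))
    (a : complex_hom K L) : Prop :=
  forall (U : opens X) (s : S U), a 0%N U (iK U s) = iL U s.

Section Kernel.
Context (A B : zmodType) (f : {additive A -> B}).

Definition ker_pred : pred A := fun x => f x == 0.

Lemma ker_pred_closed : zmod_closed ker_pred.
Proof.
split; first by rewrite unfold_in /ker_pred raddf0.
move=> x y; rewrite !unfold_in /ker_pred raddfB => /eqP-> /eqP->.
by rewrite subr0.
Qed.

HB.instance Definition _ := GRing.isZmodClosed.Build A ker_pred ker_pred_closed.

Definition ker : Type := {x : A | x \in ker_pred}.

HB.instance Definition _ := SubChoice.on ker.
HB.instance Definition _ := [SubChoice_isSubZmodule of ker by <:].

Lemma kerP (x : ker) : f (val x) = 0.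
Proof. by apply/eqP; exact: (valP x). Qed.

Definition to_ker (x : A) (fx : f x = 0) : ker :=
  exist (fun y => y \in ker_pred) x (introT eqP fx).

End Kernel.

Section KerMap.
Context (A B A' B' : zmodType).
Context (f : {additive A -> B}) (f' : {additive A' -> B'}).
Context (u : {additive A -> A'}) (uP : forall x, f x = 0 -> f' (u x) = 0).

Definition ker_map (x : ker f) : ker f' := to_ker (uP (kerP x)).

Lemma ker_map_additive : zmod_morphism ker_map.
Proof. by move=> x y; apply: val_inj; rewrite /= raddfB. Qed.

HB.instance Definition _ :=
  GRing.isZmodMorphism.Build (ker f) (ker f') ker_map ker_map_additive.

End KerMap.

Record cochain_complex := CochainComplex {
  cc_obj :> nat -> zmodType;
  cc_d : forall q, {additive cc_obj q -> cc_obj q.+1};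
  cc_dd : forall q (x : cc_obj q), cc_d q.+1 (cc_d q x) = 0 }.

Section Cohomology.
Context (C : cochain_complex).

Definition is_coboundary (q : nat) : C q -> Prop :=
  match q with
  | 0 => fun x => x = 0
  | p.+1 => fun x => exists y : C p, cc_d C p y = x
  end.

Definition cocycle (q : nat) := ker (cc_d C q).

HB.instance Definition _ q := GRing.Zmodule.on (cocycle q).

Definition coboundary (q : nat) : {pred cocycle q} :=
  fun x => `[< is_coboundary (val x) >].

Lemma coboundary_closed q : zmod_closed (@coboundary q).
Proof.
split=> [|x y]; rewrite !unfold_in.
  by apply/asboolP; case: q => [|p] //=; exists 0; rewrite raddf0.
move=> /asboolP hx /asboolP hy; apply/asboolP; move: hx hy; rewrite raddfB.
case: q x y => [|p] x y /=; first by move=> -> ->; rewrite subr0.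
by move=> [x' <-] [y' <-]; exists (x' - y'); rewrite raddfB.
Qed.

HB.instance Definition _ q :=
  GRing.isZmodClosed.Build (cocycle q) (@coboundary q) (coboundary_closed q).

Definition cohomology (q : nat) : zmodType :=
  Quotient.quot (@coboundary q).

End Cohomology.

Record cochain_map (C D : cochain_complex) := CochainMap {
  cm_app :> forall q, {additive C q -> D q};
  cm_comm : forall q (x : C q), cm_app q.+1 (cc_d C q x) = cc_d D q (cm_app q x)
}.

Section CohomologyMap.
Context (C D : cochain_complex) (f : cochain_map C D) (q : nat).

Lemma cocycle_map_subproof (x : C q) :
  cc_d C q x = 0 -> cc_d D q (f q x) = 0.
Proof. by move=> dx; rewrite -cm_comm dx raddf0. Qed.

Definition cocycle_map : cocycle C q -> cocycle D q :=
  ker_map cocycle_map_subproof.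

Definition cohomology_map (c : cohomology C q) : cohomology D q :=
  \pi_(cohomology D q) (cocycle_map (repr c)).

Lemma cohomology_mapE (x : cocycle C q) :
  cohomology_map (\pi_(cohomology C q) x) =
  \pi_(cohomology D q) (cocycle_map x).
Proof.
apply/eqP; rewrite -Quotient.idealrBE -raddfB.
have : repr (\pi_(cohomology C q) x) - x \in @coboundary C q.
  by rewrite Quotient.idealrBE reprK.
move: (_ - x) => y; rewrite !unfold_in => /asboolP yb; apply/asboolP.
rewrite /=; case: y yb => y /= _.
elim/nat_rect: q y => [|p _] y /=; first by move=> ->; rewrite raddf0.
by move=> [z <-]; exists (f p z); rewrite cm_comm.
Qed.

End CohomologyMap.

Section UnitZmodule.
Let unit_op (_ _ : unit) := tt.
Let unit_opA : associative unit_op. Proof. by []. Qed.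
Let unit_opC : commutative unit_op. Proof. by []. Qed.
Let unit_op0 : left_id tt unit_op. Proof. by case. Qed.
Let unit_opN : left_inverse tt (fun=> tt) unit_op. Proof. by []. Qed.
HB.instance Definition _ :=
  GRing.isZmodule.Build unit unit_opA unit_opC unit_op0 unit_opN.
End UnitZmodule.

Section Relative.
Context (X : topologicalType) (X' : opens X).

Local Notation resX F := (res F (@subopensT X X')).

Section Sections.
Context (K : sheaf_complex X).

(* K^{q-1}(X') and the differential K^{q-1}(X') -> K^q(X'), where K^{-1} = 0. *)
Definition prev_sec (q : nat) : zmodType :=
  match q with 0 => unit | p.+1 => K p X' end.

Definition prev_d (q : nat) : {additive prev_sec q -> K q X'} :=
  match q return {additive prev_sec q -> K q X'} with
  | 0 => \0
  | p.+1 => sc_d K p X'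
  end.

Lemma sc_d_prev_d q (s : prev_sec q) : sc_d K q X' (prev_d q s) = 0.
Proof. by case: q s => [|p] s /=; rewrite ?raddf0 ?sc_dd. Qed.

Definition rel_obj (q : nat) : zmodType := (K q (opensT X) * prev_sec q)%type.

Definition rel_d (q : nat) (xi : rel_obj q) : rel_obj q.+1 :=
  (sc_d K q (opensT X) xi.1, resX (K q) xi.1 - prev_d q xi.2).

Lemma rel_d_additive q : zmod_morphism (@rel_d q).
Proof.
move=> x y; congr pair => /=; first by rewrite raddfB.
rewrite [resX _ _]raddfB [prev_d _ _]raddfB !opprB addrACA [RHS]addrACA.
by congr (_ + _); rewrite addrC.
Qed.

HB.instance Definition _ q :=
  GRing.isZmodMorphism.Build (rel_obj q) (rel_obj q.+1) (@rel_d q)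
    (@rel_d_additive q).

Lemma rel_dd q (xi : rel_obj q) : rel_d (rel_d xi) = 0.
Proof.
rewrite /rel_d /=; congr pair; first by rewrite sc_dd.
by rewrite raddfB sc_d_prev_d subr0 hom_nat subrr.
Qed.

Definition relative_complex : cochain_complex :=
  @CochainComplex rel_obj (fun q => @rel_d q) rel_dd.

Definition van_obj (q : nat) : zmodType := ker (resX (K q)).

Lemma van_d_subproof q (s : K q (opensT X)) :
  resX (K q) s = 0 -> resX (K q.+1) (sc_d K q (opensT X) s) = 0.
Proof. by move=> s0; rewrite -hom_nat s0 raddf0. Qed.

Definition van_d (q : nat) : {additive van_obj q -> van_obj q.+1} :=
  ker_map (@van_d_subproof q).

Lemma van_dd q (s : van_obj q) : van_d q.+1 (van_d q s) = 0.
Proof. by apply: val_inj; rewrite /= sc_dd. Qed.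

Definition vanishing_complex : cochain_complex := CochainComplex van_dd.

Definition van_to_rel (q : nat) (s : van_obj q) : rel_obj q := (val s, 0).

Lemma van_to_rel_additive q : zmod_morphism (@van_to_rel q).
Proof. by move=> s t; congr pair; rewrite subr0. Qed.

HB.instance Definition _ q :=
  GRing.isZmodMorphism.Build (van_obj q) (rel_obj q) (@van_to_rel q)
    (@van_to_rel_additive q).

Lemma van_to_rel_comm q (s : van_obj q) :
  van_to_rel (van_d q s) = rel_d (van_to_rel s).
Proof.
by rewrite /rel_d /van_to_rel /=; congr pair; rewrite kerP raddf0 subr0.
Qed.

Definition vanishing_to_relative :
    cochain_map vanishing_complex relative_complex :=
  @CochainMap vanishing_complex relative_complex (fun q => @van_to_rel q)
    van_to_rel_comm.

End Sections.

Section Functoriality.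
Context (K L : sheaf_complex X) (a : complex_hom K L).

Definition prev_hom (q : nat) : {additive prev_sec K q -> prev_sec L q} :=
  match q return {additive prev_sec K q -> prev_sec L q} with
  | 0 => \0
  | p.+1 => a p X'
  end.

Lemma prev_hom_d q (s : prev_sec K q) :
  a q X' (prev_d K q s) = prev_d L q (prev_hom q s).
Proof. by case: q s => [|p] s /=; rewrite ?raddf0 ?ch_comm. Qed.

Definition rel_hom (q : nat) (xi : rel_obj K q) : rel_obj L q :=
  (a q (opensT X) xi.1, prev_hom q xi.2).

Lemma rel_hom_additive q : zmod_morphism (@rel_hom q).
Proof. by move=> x y; congr pair; rewrite /= raddfB. Qed.

HB.instance Definition _ q :=
  GRing.isZmodMorphism.Build (rel_obj K q) (rel_obj L q) (@rel_hom q)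
    (@rel_hom_additive q).

Lemma rel_hom_comm q (xi : rel_obj K q) :
  rel_hom (rel_d xi) = rel_d (rel_hom xi).
Proof.
rewrite /rel_hom /rel_d /=; congr pair; first exact: ch_comm.
by rewrite raddfB hom_nat prev_hom_d.
Qed.

Definition relative_map :
    cochain_map (relative_complex K) (relative_complex L) :=
  @CochainMap (relative_complex K) (relative_complex L) (fun q => @rel_hom q)
    rel_hom_comm.

End Functoriality.

Definition relcoh_sections (K : sheaf_complex X) (q : nat) : zmodType :=
  cohomology (relative_complex K) q.

(* H^q(X, X'; S) when F is a flabby resolution of S. *)
Definition relcoh (F : sheaf_complex X) (q : nat) : zmodType :=
  cohomology (vanishing_complex F) q.

(* The requirement that makes a map H^q_{D_K}(X, X') -> H^q(X, X'; S) canonical: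
   whenever K and F are both compared to a flabby resolution L of S by morphisms
   a : K -> L and b : F -> L inducing the identity of S, the diagram
     H^q_{D_K}(X, X') --Phi--> H^q(X, X'; S) --[s |-> (s, 0)]--> H^q_{D_F}(X, X')
            |a                                                          |b
     H^q_{D_L}(X, X') ======================================== H^q_{D_L}(X, X')
   commutes. *)
Definition canonical_comparison (S : sheaf X)
    (K : sheaf_complex X) (iK : sheaf_hom S (K 0))
    (F : sheaf_complex X) (iF : sheaf_hom S (F 0))
    (q : nat) (Phi : relcoh_sections K q -> relcoh F q) : Prop :=
  forall (L : sheaf_complex X) (iL : sheaf_hom S (L 0))
    (a : complex_hom K L) (b : complex_hom F L),
    is_resolution iL -> (forall p, flabby (L p)) ->
    resolution_hom iK iL a -> resolution_hom iF iL b ->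
  forall c : relcoh_sections K q,
    cohomology_map (relative_map a) c =
    cohomology_map (relative_map b)
      (cohomology_map (vanishing_to_relative F) (Phi c)).

End Relative.

(* Main.v *)
(* Every presheaf G has functorial Godement rows G -> god G -> god (godQ G) -> ...,
   where god G is the product of the stalks and godQ G is the presheaf cokernel
   of G -> god G.  The rows are exact on sections over Y when G is a flabby
   sheaf (then godQ G is again a flabby sheaf) and also when G is fine on the
   paracompact Y: the rows are functorial in endomorphisms of G, so a cocycle
   that is locally a coboundary can be corrected piece by piece with
   endomorphisms that are 1 near a closed set and 0 outside an open one, Zorn's
   lemma running over a shrunk locally finite cover.  A double complex chase
   then shows that an exact complex of such presheaves has exact sections over
   Y.  Applied over X and over X' to the cone of a morphism K -> L of resolutions
   with L flabby, this gives H_{D_K}(X,X') = H_{D_L}(X,X').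

   For canonicity, let M be the pushout of K and F under S.  It embeds in a
   flabby resolution L(M), and Phi is the composite through
   H_{D_{L(M)}}(X,X').  Any other flabby L1 receiving K and F receives M, and
   both L1 and L(M) map to a flabby resolution of the pushout of L1 and L(M)
   under M; these maps agree on K and on F, so no homotopy is needed. *)
From HB Require Import structures.
Require Import Defs.
From mathcomp Require Import all_boot all_order all_algebra.
From mathcomp Require Import generic_quotient.
From mathcomp Require Import all_classical topology.

Set Implicit Arguments.
Unset Strict Implicit.
Unset Printing Implicit Defensive.

Import GRing.Theory.
Local Open Scope classical_set_scope.
Local Open Scope ring_scope.
Local Open Scope quotient_scope.
Local Notation os := (@opens_set _).

(** Flabby sheaves need not be injective, so there may be no morphism between [K] and [F];
    comparison with a common target has to replace the usual lifting of maps between resolutions.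
    Cokernels are left unsheafified: [delta] sees [godQ] only through germs, and a presheaf quotient
    keeps its sections liftable over every open set, which makes its functoriality and its
    flabbiness immediate. The predicate [acyclic] speaks of sections over a single open set; it is
    what flabbiness and fineness have in common, and it passes to retracts, hence to the terms of a
    cone. On the fine side no fineness of [godQ G] is claimed: it merely carries the endomorphisms
    induced from [G], which commute with [delta]. These endomorphisms live over the open [Y] only,
    as [hom_on] does, and this lets the subspace [X'] be handled with opens of [X]. *)

Section Cokernel.
Context (A B : zmodType) (f : {additive A -> B}).

Definition im_pred : {pred B} := fun b => `[< exists a, f a = b >].

Lemma im_pred_closed : zmod_closed im_pred.
Proof.
split=> [|x y]; rewrite !unfold_in; first by apply/asboolP; exists 0; rewrite raddf0.
move=> /asboolP[a <-] /asboolP[b <-]; apply/asboolP; exists (a - b).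
by rewrite raddfB.
Qed.

HB.instance Definition _ := GRing.isZmodClosed.Build B im_pred im_pred_closed.

Definition coker : zmodType := Quotient.quot im_pred.

Definition coker_pi (b : B) : coker := \pi_coker b.

Lemma coker_pi_additive : zmod_morphism coker_pi.
Proof. by move=> x y; rewrite /coker_pi raddfB. Qed.

HB.instance Definition _ :=
  GRing.isZmodMorphism.Build B coker coker_pi coker_pi_additive.

Lemma coker_pi_surj (c : coker) : exists b, coker_pi b = c.
Proof. by exists (repr c); rewrite /coker_pi reprK. Qed.

Lemma coker_pi_eq0 b : coker_pi b = 0 <-> exists a, f a = b.
Proof.
have -> : (0 : coker) = coker_pi 0 by rewrite raddf0.
have := Quotient.idealrBE (im_pred : zmodClosed B) b 0.
rewrite subr0 unfold_in => bE; split=> [b0|ex].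
  by apply/asboolP; rewrite bE; apply/eqP.
by apply/eqP; rewrite -bE; apply/asboolP.
Qed.

Lemma coker_pi_eq b b' : coker_pi b = coker_pi b' <-> exists a, f a = b - b'.
Proof.
have piB : coker_pi (b - b') = coker_pi b - coker_pi b' by exact: coker_pi_additive.
rewrite -coker_pi_eq0 piB; split=> [bb'|/eqP]; first by rewrite bb' subrr.
by rewrite subr_eq0 => /eqP.
Qed.

Context (C : zmodType) (g : {additive B -> C}) (gf : forall a, g (f a) = 0).

Definition coker_lift_fun (c : coker) : C := g (repr c).

Lemma coker_lift_funE b : coker_lift_fun (coker_pi b) = g b.
Proof.
have /coker_pi_eq[a aE] : coker_pi (repr (coker_pi b)) = coker_pi b.
  by rewrite /coker_pi reprK.
by apply/eqP; rewrite -subr_eq0 -raddfB -aE gf.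
Qed.

Lemma coker_lift_additive : zmod_morphism coker_lift_fun.
Proof.
move=> x y; have [[a <-] [b <-]] := (coker_pi_surj x, coker_pi_surj y).
by rewrite -raddfB !coker_lift_funE raddfB.
Qed.

HB.instance Definition _ :=
  GRing.isZmodMorphism.Build coker C coker_lift_fun coker_lift_additive.

Definition coker_lift : {additive coker -> C} := coker_lift_fun.

Lemma coker_liftE b : coker_lift (coker_pi b) = g b.
Proof. exact: coker_lift_funE. Qed.

End Cokernel.


(** * Presheaf morphisms, products and cokernels *)

Section Presheaves.
Context (X : topologicalType).
Implicit Types (U V W : opens X) (A B C : presheaf X).

(** The predicate receives the inclusion because restriction maps take it as an argument. *)
Definition locally_on U (P : forall V, V `<=` U -> Prop) : Prop :=
  forall x, os U x -> exists V (VU : V `<=` U), os V x /\ P V VU.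

Lemma opensIl U V : opensI U V `<=` U. Proof. by move=> x []. Qed.
Lemma opensIr U V : opensI U V `<=` V. Proof. by move=> x []. Qed.

Lemma resK A U V (VU : V `<=` U) (UV : U `<=` V) (s : A U) :
  res A UV (res A VU s) = s.
Proof. by rewrite (res_comp _ _ (@subset_refl _ U)) res_id. Qed.

Definition psh_zero_obj (U : opens X) : zmodType := unit.

Definition psh_zero : presheaf X.
Proof.
by refine (@Presheaf X psh_zero_obj
  (fun U V _ => idfun : {additive unit -> unit}) _ _).
Defined.

Lemma psh_zero_eq U (s t : psh_zero U) : s = t.
Proof. by case: s t => -[]. Qed.

Definition hom_comp A B C (g : sheaf_hom B C) (f : sheaf_hom A B) :
  sheaf_hom A C.
Proof.
by refine (@SheafHom X A C (fun U => g U \o f U) _) => U V VU s /=; rewrite !hom_nat.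
Defined.

Definition hom_id A : sheaf_hom A A.
Proof. by refine (@SheafHom X A A (fun U => idfun) _). Defined.

Definition hom_zero A B : sheaf_hom A B.
Proof.
by refine (@SheafHom X A B (fun U => \0) _) => U V VU s /=; rewrite raddf0.
Defined.

Definition hom_opp A B (f : sheaf_hom A B) : sheaf_hom A B.
Proof.
refine (@SheafHom X A B (fun U => \- (f U)) _) => U V VU s /=.
by rewrite hom_nat raddfN.
Defined.

Section Prod.
Context (A B : presheaf X).

Definition prod_res_fun U V (VU : V `<=` U) (s : A U * B U) : A V * B V :=
  (res A VU s.1, res B VU s.2).

Lemma prod_res_additive U V (VU : V `<=` U) : zmod_morphism (prod_res_fun VU).
Proof. by move=> s t; congr pair; rewrite /= raddfB. Qed.

HB.instance Definition _ U V (VU : V `<=` U) :=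
  GRing.isZmodMorphism.Build (A U * B U)%type (A V * B V)%type
    (prod_res_fun VU) (prod_res_additive VU).

Definition psh_prod : presheaf X.
Proof.
refine (@Presheaf X (fun U => (A U * B U)%type)
  (fun U V VU => prod_res_fun VU) _ _).
- by move=> U UU [s t]; rewrite /= /prod_res_fun /= !res_id.
- by move=> U V W VU WV WU [s t]; rewrite /= /prod_res_fun /= !(res_comp _ _ WU).
Defined.

Definition hom_fst : sheaf_hom psh_prod A.
Proof. by refine (@SheafHom X psh_prod A (fun U => fst) _). Defined.

Definition hom_snd : sheaf_hom psh_prod B.
Proof. by refine (@SheafHom X psh_prod B (fun U => snd) _). Defined.

Section Pair.
Context (C : presheaf X) (f : sheaf_hom C A) (g : sheaf_hom C B).

Definition pair_fun U (s : C U) : psh_prod U := (f U s, g U s).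

Lemma pair_fun_additive U : zmod_morphism (@pair_fun U).
Proof. by move=> s t; congr pair; rewrite /= raddfB. Qed.

HB.instance Definition _ U :=
  GRing.isZmodMorphism.Build (C U) (psh_prod U) (@pair_fun U)
    (@pair_fun_additive U).

Definition hom_pair : sheaf_hom C psh_prod.
Proof.
refine (@SheafHom X C psh_prod (fun U => @pair_fun U) _) => U V VU s.
by congr pair; rewrite /= hom_nat.
Defined.

End Pair.

Section Copair.
Context (C : presheaf X) (f : sheaf_hom A C) (g : sheaf_hom B C).

Definition copair_fun U (s : psh_prod U) : C U := f U s.1 + g U s.2.

Lemma copair_fun_additive U : zmod_morphism (@copair_fun U).
Proof. by move=> s t; rewrite /copair_fun /= !raddfB addrACA opprD. Qed.

HB.instance Definition _ U :=
  GRing.isZmodMorphism.Build (psh_prod U) (C U) (@copair_fun U)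
    (@copair_fun_additive U).

Definition hom_copair : sheaf_hom psh_prod C.
Proof.
refine (@SheafHom X psh_prod C (fun U => @copair_fun U) _) => U V VU s.
by rewrite /= /copair_fun /= raddfD !hom_nat.
Defined.

End Copair.

Definition hom_inl : sheaf_hom A psh_prod := hom_pair (hom_id A) (hom_zero A B).
Definition hom_inr : sheaf_hom B psh_prod := hom_pair (hom_zero B A) (hom_id B).

End Prod.

Section CokerPresheaf.
Context (A B : presheaf X) (f : sheaf_hom A B).

Lemma coker_res_subproof U V (VU : V `<=` U) (a : A U) :
  (coker_pi (f V) \o res B VU) (f U a) = 0.
Proof. by apply/coker_pi_eq0; exists (res A VU a); rewrite hom_nat. Qed.

Definition coker_res U V (VU : V `<=` U) :
    {additive coker (f U) -> coker (f V)} :=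
  coker_lift (coker_res_subproof VU).

Lemma coker_resE U V (VU : V `<=` U) b :
  coker_res VU (coker_pi (f U) b) = coker_pi (f V) (res B VU b).
Proof. exact: coker_liftE. Qed.

Definition psh_coker : presheaf X.
Proof.
refine (@Presheaf X (fun U => coker (f U)) coker_res _ _).
- by move=> U UU s; have [b <-] := coker_pi_surj s; rewrite coker_resE res_id.
- move=> U V W VU WV WU s; have [b <-] := coker_pi_surj s.
  by rewrite !coker_resE (res_comp _ _ WU).
Defined.

Definition hom_pi : sheaf_hom B psh_coker.
Proof.
refine (@SheafHom X B psh_coker (fun U => coker_pi (f U)) _) => U V VU s.
exact/esym/coker_resE.
Defined.

Lemma hom_pi_surj U (c : psh_coker U) : exists b, hom_pi U b = c.
Proof. exact: coker_pi_surj. Qed.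

Lemma hom_pi_eq0 U b : hom_pi U b = 0 <-> exists a, f U a = b.
Proof. exact: coker_pi_eq0. Qed.

Lemma hom_pi_eq U b b' : hom_pi U b = hom_pi U b' <-> exists a, f U a = b - b'.
Proof. exact: coker_pi_eq. Qed.

Context (C : presheaf X) (g : sheaf_hom B C)
  (gf : forall U (a : A U), g U (f U a) = 0).

Definition hom_lift : sheaf_hom psh_coker C.
Proof.
refine (@SheafHom X psh_coker C (fun U => coker_lift (@gf U)) _) => U V VU s.
have [b <-] := coker_pi_surj s; rewrite (coker_liftE (@gf U)) -hom_nat.
by rewrite (coker_resE VU b : res psh_coker VU _ = _) (coker_liftE (@gf V)).
Defined.

Lemma hom_liftE U b : hom_lift U (hom_pi U b) = g U b.
Proof. exact: coker_liftE. Qed.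

End CokerPresheaf.

End Presheaves.

(** * Stalks as abelian groups and the maps between them *)

Section StalkGroup.
Context (X : topologicalType) (F : presheaf X) (x : X).

Lemma germ_eq (U V : opens X) (Ux : os U x) (Vx : os V x) (s : F U) (t : F V) :
  germ Ux s = germ Vx t <->
  exists (W : opens X) (WU : W `<=` U) (WV : W `<=` V),
    os W x /\ res F WU s = res F WV t.
Proof.
split=> [/eqP|sW]; first by rewrite /germ eqmodE /= => /asboolP.
by apply/eqP; rewrite /germ eqmodE /=; apply/asboolP.
Qed.

Lemma germ_res (U V : opens X) (VU : V `<=` U) (Vx : os V x) (Ux : os U x)
  (s : F U) : germ Vx (res F VU s) = germ Ux s.
Proof.
by apply/germ_eq; exists V, (@subset_refl _ V), VU; rewrite res_id.
Qed.

Lemma stalk_germ (z : stalk F x) :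
  exists (U : opens X) (Ux : os U x) (s : F U), z = germ Ux s.
Proof.
case: (repr z) (reprK z) => U Ux s <-; by exists U, Ux, s.
Qed.

Lemma stalk_germ2 (z w : stalk F x) :
  exists (U : opens X) (Ux : os U x) (s t : F U), z = germ Ux s /\ w = germ Ux t.
Proof.
have [U [Ux [s ->]]] := stalk_germ z; have [V [Vx [t ->]]] := stalk_germ w.
pose Ix : os (opensI U V) x := conj Ux Vx.
exists (opensI U V), Ix, (res F (@opensIl _ U V) s).
by exists (res F (@opensIr _ U V) t); rewrite !(germ_res _ Ix).
Qed.

Lemma stalk_germ3 (z w v : stalk F x) :
  exists (U : opens X) (Ux : os U x) (s t u : F U),
    [/\ z = germ Ux s, w = germ Ux t & v = germ Ux u].
Proof.
have [U [Ux [s [t [-> ->]]]]] := stalk_germ2 z w.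
have [V [Vx [u ->]]] := stalk_germ v.
pose Ix : os (opensI U V) x := conj Ux Vx.
exists (opensI U V), Ix, (res F (@opensIl _ U V) s).
exists (res F (@opensIl _ U V) t), (res F (@opensIr _ U V) u).
by rewrite !(germ_res _ Ix).
Qed.

HB.instance Definition _ := gen_eqMixin (stalk F x).
HB.instance Definition _ := gen_choiceMixin (stalk F x).

Definition stalk_zero : stalk F x := @germ X F x (opensT X) Logic.I 0.

Definition stalk_opp (z : stalk F x) : stalk F x :=
  germ (ls_domx (repr z)) (- ls_sec (repr z)).

Definition stalk_add (z w : stalk F x) : stalk F x :=
  @germ X F x (opensI (ls_dom (repr z)) (ls_dom (repr w)))
    (conj (ls_domx (repr z)) (ls_domx (repr w)))
    (res F (@opensIl _ _ _) (ls_sec (repr z)) +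
     res F (@opensIr _ _ _) (ls_sec (repr w))).

Lemma germ_repr (z : stalk F x) : germ (ls_domx (repr z)) (ls_sec (repr z)) = z.
Proof. by rewrite -[RHS]reprK; case: (repr z). Qed.

Lemma stalk_zeroE (U : opens X) (Ux : os U x) : germ Ux (0 : F U) = stalk_zero.
Proof. by rewrite /stalk_zero -[RHS](germ_res (@subopensT X U) Ux) raddf0. Qed.

Lemma stalk_oppE (U : opens X) (Ux : os U x) (s : F U) :
  stalk_opp (germ Ux s) = germ Ux (- s).
Proof.
rewrite /stalk_opp; have /germ_eq[W [Wr [WU [Wx e]]]] := germ_repr (germ Ux s).
by apply/germ_eq; exists W, Wr, WU; split=> //; rewrite !raddfN e.
Qed.

Lemma stalk_addE (U : opens X) (Ux : os U x) (s t : F U) :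
  stalk_add (germ Ux s) (germ Ux t) = germ Ux (s + t).
Proof.
rewrite /stalk_add.
have /germ_eq[W [Wr [WU [Wx e]]]] := germ_repr (germ Ux s).
have /germ_eq[W' [Wr' [WU' [Wx' e']]]] := germ_repr (germ Ux t).
have IW : opensI W W' `<=` W by exact: opensIl.
have IW' : opensI W W' `<=` W' by exact: opensIr.
have II : opensI W W' `<=` opensI (ls_dom (repr (germ Ux s)))
                                  (ls_dom (repr (germ Ux t))).
  by move=> y [/Wr + /Wr'].
apply/germ_eq; exists (opensI W W'), II, (subset_trans IW WU).
split=> //; rewrite !raddfD.
rewrite !(res_comp _ II (subset_trans IW Wr)).
rewrite !(res_comp _ II (subset_trans IW' Wr')).
rewrite -(res_comp Wr IW) e (res_comp _ _ (subset_trans IW WU)).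
by rewrite -(res_comp Wr' IW') e' (res_comp _ _ (subset_trans IW WU)).
Qed.

Lemma stalk_addA : associative stalk_add.
Proof.
move=> z w v; have [U [Ux [s [t [u [-> -> ->]]]]]] := stalk_germ3 z w v.
by rewrite !stalk_addE addrA.
Qed.

Lemma stalk_addC : commutative stalk_add.
Proof.
move=> z w; have [U [Ux [s [t [-> ->]]]]] := stalk_germ2 z w.
by rewrite !stalk_addE addrC.
Qed.

Lemma stalk_add0 : left_id stalk_zero stalk_add.
Proof.
move=> z; have [U [Ux [s ->]]] := stalk_germ z.
by rewrite -(stalk_zeroE Ux) stalk_addE add0r.
Qed.

Lemma stalk_addN : left_inverse stalk_zero stalk_opp stalk_add.
Proof.
move=> z; have [U [Ux [s ->]]] := stalk_germ z.
by rewrite stalk_oppE stalk_addE addNr stalk_zeroE.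
Qed.

HB.instance Definition _ := GRing.isZmodule.Build (stalk F x)
  stalk_addA stalk_addC stalk_add0 stalk_addN.

Lemma germ_additive (U : opens X) (Ux : os U x) :
  zmod_morphism (@germ X F x U Ux : F U -> stalk F x).
Proof. by move=> s t; rewrite -stalk_addE -stalk_oppE. Qed.

HB.instance Definition _ (U : opens X) (Ux : os U x) :=
  GRing.isZmodMorphism.Build (F U) (stalk F x) (@germ X F x U Ux)
    (germ_additive Ux).

Lemma germ_eq0 (U : opens X) (Ux : os U x) (s : F U) :
  germ Ux s = 0 <->
  exists (W : opens X) (WU : W `<=` U), os W x /\ res F WU s = 0.
Proof.
rewrite -[X in _ = X](stalk_zeroE Ux); split=> [/germ_eq[W [WU [WU' [Wx e]]]]|].
  by exists W, WU; rewrite e raddf0.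
move=> [W [WU [Wx e]]]; apply/germ_eq; exists W, WU, WU.
by rewrite e raddf0.
Qed.

End StalkGroup.

Section StalkMap.
Context (X : topologicalType) (F G : presheaf X) (Y : opens X).
Context (f : hom_on F G Y) (x : X) (Yx : os Y x).

(** As [f] acts only on opens inside [Y], the representative is first restricted to its intersection
    with [Y]. *)
Definition stalk_map (z : stalk F x) : stalk G x :=
  @germ X G x (opensI (ls_dom (repr z)) Y) (conj (ls_domx (repr z)) Yx)
    (ho_app f (@opensIr _ _ _) (res F (@opensIl _ _ _) (ls_sec (repr z)))).

Lemma stalk_mapE (U : opens X) (UY : U `<=` Y) (Ux : os U x) (s : F U) :
  stalk_map (germ Ux s) = germ Ux (ho_app f UY s).
Proof.
rewrite /stalk_map; have /germ_eq[W [Wr [WU [Wx e]]]] := germ_repr (germ Ux s).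
have WY := subset_trans WU UY.
have WI : W `<=` opensI (ls_dom (repr (germ Ux s))) Y.
  by move=> y Wy; split; [exact: (Wr y Wy) | exact: (WY y Wy)].
apply/germ_eq; exists W, WI, WU; split=> //.
by rewrite -!(ho_nat _ _ _ WY) (res_comp _ _ Wr) e.
Qed.

Lemma stalk_germ_in (z : stalk F x) :
  exists (U : opens X) (UY : U `<=` Y) (Ux : os U x) (s : F U), z = germ Ux s.
Proof.
have [U [Ux [s ->]]] := stalk_germ z.
exists (opensI U Y), (@opensIr _ U Y), (conj Ux Yx).
by exists (res F (@opensIl _ U Y) s); rewrite (germ_res _ _ Ux).
Qed.

Lemma stalk_map_additive : zmod_morphism stalk_map.
Proof.
move=> z w; have [U [Ux [s [t [-> ->]]]]] := stalk_germ2 z w.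
pose V := opensI U Y; pose Vx : os V x := conj Ux Yx.
rewrite -(germ_res (@opensIl _ U Y) Vx Ux s) -(germ_res (@opensIl _ U Y) Vx Ux t).
rewrite -germ_additive !(stalk_mapE (@opensIr _ U Y)) -germ_additive.
apply: (congr1 (germ Vx)); apply/eqP; rewrite eq_sym subr_eq -ho_add.
by rewrite subrK.
Qed.

HB.instance Definition _ :=
  GRing.isZmodMorphism.Build (stalk F x) (stalk G x) stalk_map
    stalk_map_additive.

End StalkMap.

(** * Gluing in sheaves *)

Section Gluing.
Context (X : topologicalType) (G : presheaf X) (sG : is_sheaf G) (U : opens X).

Lemma sheaf_locally_eq (s t : G U) :
  locally_on (fun (V : opens X) (VU : V `<=` U) => res G VU s = res G VU t) -> s = t.
Proof.
move=> st.
pose V (i : {x | os U x}) := projT1 (cid (st (sval i) (svalP i))).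
have VP i : exists VU : V i `<=` U,
    os (V i) (sval i) /\ res G VU s = res G VU t.
  exact: projT2 (cid (st (sval i) (svalP i))).
have VU i : V i `<=` U by have [VU _] := VP i.
apply: (@sheaf_ext X G U _ V VU) => // [x Ux|i].
  by exists (exist _ x Ux) => //; have [? []] := VP (exist _ x Ux).
by have [VU' [_]] := VP i; rewrite (Prop_irrelevance VU' (VU i)).
Qed.

Lemma sheaf_locally_eq0 (s : G U) :
  locally_on (fun (V : opens X) (VU : V `<=` U) => res G VU s = 0) -> s = 0.
Proof.
move=> s0; apply: sheaf_locally_eq => x /s0[V [VU [Vx e]]].
by exists V, VU; rewrite raddf0.
Qed.

(** [P] prescribes the values of the glued section. Giving them by a relation that is stable under
    restriction and single-valued spares the choice of an indexed cover, and the result is then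
    known on every open where [P] holds, not only on the members of a cover. *)
Lemma sheaf_glue (P : forall V : opens X, V `<=` U -> G V -> Prop) :
  (forall (V W : opens X) (VU : V `<=` U) (WV : W `<=` V) (WU : W `<=` U) t,
     P V VU t -> P W WU (res G WV t)) ->
  (forall (V : opens X) (VU : V `<=` U) t t', P V VU t -> P V VU t' -> t = t') ->
  locally_on (fun (V : opens X) (VU : V `<=` U) => exists t, P V VU t) ->
  exists t : G U, forall (V : opens X) (VU : V `<=` U) t', P V VU t' -> res G VU t = t'.
Proof.
move=> Pres Puniq Ploc.
pose V (i : {x | os U x}) := projT1 (cid (Ploc (sval i) (svalP i))).
have VP i : exists VU : V i `<=` U,
    os (V i) (sval i) /\ exists t, P (V i) VU t.
  exact: projT2 (cid (Ploc (sval i) (svalP i))).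
have VU i : V i `<=` U by have [VU _] := VP i.
have sex i : exists t, P (V i) (VU i) t.
  by have [VU' [_]] := VP i; rewrite (Prop_irrelevance VU' (VU i)).
pose s i := projT1 (cid (sex i)).
have sP i : P (V i) (VU i) (s i) := projT2 (cid (sex i)).
have Ucov : U `<=` \bigcup_i V i.
  by move=> x Ux; exists (exist _ x Ux) => //; have [? []] := VP (exist _ x Ux).
have [|t [tP _]] := sG VU Ucov (s := s).
  move=> i j W Wi Wj; have WU := subset_trans Wi (VU i).
  by apply: (Puniq W WU); apply: Pres (sP _).
exists t => W WU t' Pt'.
pose WI i := opensI W (V i).
apply: (@sheaf_ext X G W _ WI (fun i => @opensIl _ W (V i))) => //.
  by move=> x Wx; have [i _ Vx] := Ucov _ (WU _ Wx); exists i.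
move=> i; have IU : WI i `<=` U := subset_trans (@opensIl _ W (V i)) WU.
rewrite (res_comp _ _ IU) -(res_comp (VU i) (@opensIr _ W (V i)) IU) tP.
by apply: (Puniq (WI i) IU); [apply: Pres (sP i)|apply: Pres Pt'].
Qed.

End Gluing.

(** * The Godement construction and its differential *)

Section Godement.
Context (X : topologicalType) (F : presheaf X).

Definition disc (U : opens X) := forall x : X, os U x -> stalk F x.

Lemma disc_ext (U : opens X) (s t : disc U) :
  (forall x (Ux : os U x), s x Ux = t x Ux) -> s = t.
Proof.
move=> st; apply: functional_extensionality_dep => x.
exact: functional_extensionality_dep.
Qed.

Section DiscGroup.
Context (U : opens X).

HB.instance Definition _ := gen_eqMixin (disc U).
HB.instance Definition _ := gen_choiceMixin (disc U).

Let addd (s t : disc U) : disc U := fun x Ux => s x Ux + t x Ux.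
Let oppd (s : disc U) : disc U := fun x Ux => - s x Ux.
Let zerod : disc U := fun x Ux => 0.
Let adddA : associative addd.
Proof. by move=> s t u; apply: disc_ext => x Ux; exact: addrA. Qed.
Let adddC : commutative addd.
Proof. by move=> s t; apply: disc_ext => x Ux; exact: addrC. Qed.
Let add0d : left_id zerod addd.
Proof. by move=> s; apply: disc_ext => x Ux; exact: add0r. Qed.
Let addNd : left_inverse zerod oppd addd.
Proof. by move=> s; apply: disc_ext => x Ux; exact: addNr. Qed.

HB.instance Definition _ :=
  GRing.isZmodule.Build (disc U) adddA adddC add0d addNd.

End DiscGroup.

Definition disc_res (U V : opens X) (VU : V `<=` U) (s : disc U) : disc V :=
  fun x Vx => s x (VU x Vx).

Lemma disc_res_additive (U V : opens X) (VU : V `<=` U) :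
  zmod_morphism (disc_res VU).
Proof. by []. Qed.

HB.instance Definition _ (U V : opens X) (VU : V `<=` U) :=
  GRing.isZmodMorphism.Build (disc U) (disc V) (disc_res VU)
    (disc_res_additive VU).

Definition god : presheaf X.
Proof.
refine (@Presheaf X (fun U => disc U) (fun U V VU => disc_res VU) _ _).
- move=> U UU s; apply: disc_ext => x Ux; rewrite /= /disc_res.
  by rewrite (Prop_irrelevance (UU x Ux) Ux).
- move=> U V W VU WV WU s; apply: disc_ext => x Wx; rewrite /= /disc_res.
  by congr (s x _); exact: Prop_irrelevance.
Defined.

Lemma god_irr (U : opens X) (s : god U) x (Ux Ux' : os U x) : s x Ux = s x Ux'.
Proof. by rewrite (Prop_irrelevance Ux Ux'). Qed.

Lemma god_is_sheaf : is_sheaf god.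
Proof.
move=> U I V VU UV s sV.
have iP x (Ux : os U x) : exists i, os (V i) x by have [i] := UV x Ux; exists i.
pose i x Ux := projT1 (cid (iP x Ux)).
have iV x Ux : os (V (i x Ux)) x := projT2 (cid (iP x Ux)).
exists (fun x Ux => s (i x Ux) x (iV x Ux)); split=> [j|t tP]; last first.
  by apply: disc_ext => x Ux; rewrite -(tP (i x Ux)) /= /disc_res; exact: god_irr.
apply: disc_ext => x Vx; rewrite /= /disc_res /=.
move: (iV _ _) => Vx'; set k := i _ _ in Vx' *.
have := sV k j (opensI (V k) (V j)) (@opensIl _ _ _) (@opensIr _ _ _).
move=> /(congr1 (fun u : disc (opensI (V k) (V j)) => u x (conj Vx' Vx))) /=; rewrite /disc_res.
by rewrite (god_irr (s k) _ Vx') (god_irr (s j) _ Vx).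
Qed.

Definition god_sheaf : sheaf X := Sheaf god_is_sheaf.

Lemma god_flabby : flabby god.
Proof.
move=> U s.
exists (fun x _ => if pselect (os U x) is left Ux then s x Ux else 0).
apply: disc_ext => x Ux; rewrite /= /disc_res.
by case: pselect => // Ux'; exact: god_irr.
Qed.

Definition eta_fun (U : opens X) (s : F U) : god U := fun x Ux => germ Ux s.

Lemma eta_fun_additive U : zmod_morphism (@eta_fun U).
Proof. by move=> s t; apply: disc_ext => x Ux; exact: germ_additive. Qed.

HB.instance Definition _ U :=
  GRing.isZmodMorphism.Build (F U) (god U) (@eta_fun U) (@eta_fun_additive U).

Definition eta : sheaf_hom F god.
Proof.
refine (@SheafHom X F god (fun U => @eta_fun U) _) => U V VU s.
by apply: disc_ext => x Vx; exact: germ_res.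
Defined.

Lemma eta_eq0 (U : opens X) (s : F U) :
  eta U s = 0 <-> locally_on (fun (V : opens X) (VU : V `<=` U) => res F VU s = 0).
Proof.
split=> [s0 x Ux|s0].
  have /germ_eq0[W [WU [Wx e]]] : germ Ux s = 0.
    exact: (congr1 (fun u : disc U => u x Ux) s0).
  by exists W, WU.
by apply: disc_ext => x Ux; apply/germ_eq0; exact: s0.
Qed.

Lemma eta_inj (sF : is_sheaf F) (U : opens X) (s : F U) : eta U s = 0 -> s = 0.
Proof. by move=> /eta_eq0; exact: sheaf_locally_eq0. Qed.

(** Preimages under [eta] are unique because [F] is a sheaf, hence local ones glue. *)
Lemma eta_glue (sF : is_sheaf F) (U : opens X) (t : god U) :
  locally_on (fun (V : opens X) (VU : V `<=` U) => exists s, eta V s = res god VU t) ->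
  exists s, eta U s = t.
Proof.
move=> tF.
have [|V VU s s' e e'|s sP] := sheaf_glue sF _ _ tF.
- move=> V W VU WV WU s e; rewrite hom_nat e; exact: res_comp.
- apply/eqP; rewrite -subr_eq0; apply/eqP/(eta_inj sF).
  by rewrite raddfB e e' subrr.
exists s; apply: (sheaf_locally_eq god_is_sheaf) => x /tF[V [VU [Vx [s' e]]]].
by exists V, VU; split=> //; rewrite -hom_nat (sP V VU s').
Qed.

Definition godQ : presheaf X := psh_coker eta.

Definition piQ : sheaf_hom god godQ := hom_pi eta.

Lemma piQ_surj U (c : godQ U) : exists t, piQ U t = c.
Proof. exact: hom_pi_surj. Qed.

End Godement.

Section Delta.
Context (X : topologicalType).

Definition delta (F : presheaf X) : sheaf_hom (god F) (god (godQ F)) :=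
  hom_comp (eta (godQ F)) (piQ F).

(** [eta] kills exactly the locally zero sections, so going through the presheaf cokernel yields the
    kernel that the sheaf cokernel would yield. *)
Lemma delta_eq0 (F : presheaf X) U (t : god F U) :
  delta F U t = 0 <->
  locally_on (fun (V : opens X) (VU : V `<=` U) => exists s, eta F V s = res (god F) VU t).
Proof.
have dE : delta F U t = eta (godQ F) U (piQ F U t) by [].
rewrite dE eta_eq0; split=> tP x /tP[V [VU [Vx e]]]; exists V, VU; split=> //.
  by apply/hom_pi_eq0; rewrite [LHS](hom_nat (piQ F)).
by move/hom_pi_eq0: e => e; rewrite -hom_nat.
Qed.

Lemma delta_eta (F : presheaf X) U (s : F U) : delta F U (eta F U s) = 0.
Proof.
by apply/delta_eq0 => x Ux; exists U, (@subset_refl _ U); split=> //;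
  exists s; rewrite res_id.
Qed.

Lemma delta_delta (F : presheaf X) U (t : god F U) :
  delta (godQ F) U (delta F U t) = 0.
Proof. exact: delta_eta. Qed.

End Delta.

(** * Functoriality of the Godement rows over an open set *)

Section HomOn.
Context (X : topologicalType) (Y : opens X).
Implicit Types (F G A B : presheaf X) (U V W Z : opens X).

Lemma ho_app_additive F G (f : hom_on F G Y) (V : opens X) (VY : V `<=` Y) :
  zmod_morphism (ho_app f VY).
Proof. by move=> s t; apply/eqP; rewrite eq_sym subr_eq -ho_add subrK. Qed.

HB.instance Definition _ F G (f : hom_on F G Y) (V : opens X) (VY : V `<=` Y) :=
  GRing.isZmodMorphism.Build (F V) (G V) (ho_app f VY) (ho_app_additive f VY).

Definition ho_of F G (f : sheaf_hom F G) : hom_on F G Y.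
Proof.
refine (@HomOn X F G Y (fun V _ => f V) _ _).
  by move=> V _ s t; rewrite raddfD.
by move=> V W VY WV WY s; rewrite hom_nat.
Defined.

Section Maps.
Context F G (f : hom_on F G Y).

Definition god_map : hom_on (god F) (god G) Y.
Proof.
refine (@HomOn X (god F) (god G) Y
  (fun V VY t x Vx => stalk_map f (VY x Vx) (t x Vx)) _ _).
- by move=> V VY s t; apply: disc_ext => x Vx; exact: raddfD.
- move=> V W VY WV WY s; apply: disc_ext => x Wx.
  by rewrite /= /disc_res (Prop_irrelevance (WY x Wx) (VY x (WV x Wx))).
Defined.

Lemma god_map_eta V (VY : V `<=` Y) s :
  ho_app god_map VY (eta F V s) = eta G V (ho_app f VY s).
Proof. by apply: disc_ext => x Vx; exact: stalk_mapE. Qed.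

Lemma godQ_map_subproof V (VY : V `<=` Y) s :
  (piQ G V \o ho_app god_map VY) (eta F V s) = 0.
Proof.
by apply/hom_pi_eq0; exists (ho_app f VY s); exact/esym/god_map_eta.
Qed.

Definition godQ_map_fun V (VY : V `<=` Y) : {additive godQ F V -> godQ G V} :=
  coker_lift (godQ_map_subproof VY).

Lemma godQ_map_funE V (VY : V `<=` Y) t :
  godQ_map_fun VY (piQ F V t) = piQ G V (ho_app god_map VY t).
Proof. exact: coker_liftE. Qed.

Definition godQ_map : hom_on (godQ F) (godQ G) Y.
Proof.
refine (@HomOn X (godQ F) (godQ G) Y (fun V VY => godQ_map_fun VY) _ _).
- by move=> V VY s t; exact: raddfD.
- move=> V W VY WV WY s; have [t <-] := piQ_surj s.
  by rewrite -hom_nat !godQ_map_funE -hom_nat -(ho_nat _ VY).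
Defined.

Lemma godQ_map_pi V (VY : V `<=` Y) t :
  ho_app godQ_map VY (piQ F V t) = piQ G V (ho_app god_map VY t).
Proof. exact: godQ_map_funE. Qed.

End Maps.

Lemma delta_god_map F G (f : hom_on F G Y) V (VY : V `<=` Y) t :
  ho_app (god_map (godQ_map f)) VY (delta F V t) =
  delta G V (ho_app (god_map f) VY t).
Proof. by rewrite [LHS]god_map_eta godQ_map_pi. Qed.

Section Functoriality.
Context (W : opens X) (WY : W `<=` Y).

(** Being the identity, or zero below, is asked on all opens inside an open set: in this form it
    passes to stalks, hence to [god] and [godQ]. *)
Definition id_on F (f : hom_on F F Y) := forall V (VY : V `<=` Y) s,
  V `<=` W -> ho_app f VY s = s.

Definition zero_on F G (f : hom_on F G Y) := forall V (VY : V `<=` Y) s,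
  V `<=` W -> ho_app f VY s = 0.

Lemma god_map_id_on F (f : hom_on F F Y) : id_on f -> id_on (god_map f).
Proof.
move=> fid V VY t VW; apply: disc_ext => x Vx /=.
have [U [UV [Ux [s ->]]]] := stalk_germ_in Vx (t x Vx).
by rewrite (stalk_mapE f _ (subset_trans UV VY)) fid//; exact: subset_trans UV VW.
Qed.

Lemma godQ_map_id_on F (f : hom_on F F Y) : id_on f -> id_on (godQ_map f).
Proof.
move=> fid V VY c VW; have [t <-] := piQ_surj c.
by rewrite godQ_map_pi god_map_id_on.
Qed.

Lemma god_map_zero_on F G (f : hom_on F G Y) : zero_on f -> zero_on (god_map f).
Proof.
move=> f0 V VY t VW; apply: disc_ext => x Vx /=.
have [U [UV [Ux [s ->]]]] := stalk_germ_in Vx (t x Vx).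
rewrite (stalk_mapE f _ (subset_trans UV VY)) f0 ?raddf0//.
exact: subset_trans UV VW.
Qed.

Lemma godQ_map_zero_on F G (f : hom_on F G Y) : zero_on f -> zero_on (godQ_map f).
Proof.
move=> f0 V VY c VW; have [t <-] := piQ_surj c.
by rewrite godQ_map_pi god_map_zero_on// raddf0.
Qed.

End Functoriality.

Definition comp_zero F G A (f : hom_on F G Y) (g : hom_on G A Y) :=
  forall V (VY : V `<=` Y) s, ho_app g VY (ho_app f VY s) = 0.

Lemma god_map_comp_zero F G A (f : hom_on F G Y) (g : hom_on G A Y) :
  comp_zero f g -> comp_zero (god_map f) (god_map g).
Proof.
move=> gf V VY t; apply: disc_ext => x Vx /=.
have [U [UV [Ux [s ->]]]] := stalk_germ_in Vx (t x Vx).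
have UY := subset_trans UV VY.
by rewrite (stalk_mapE f _ UY) (stalk_mapE g _ UY) gf raddf0.
Qed.

Lemma godQ_map_comp_zero F G A (f : hom_on F G Y) (g : hom_on G A Y) :
  comp_zero f g -> comp_zero (godQ_map f) (godQ_map g).
Proof.
move=> gf V VY c; have [t <-] := piQ_surj c.
by rewrite !godQ_map_pi god_map_comp_zero// raddf0.
Qed.

(** This makes [G] a retract of the product of [A] and [B], in a form that is visibly preserved by
    additive functors. *)
Definition splits G A B (p1 : hom_on G A Y) (i1 : hom_on A G Y)
    (p2 : hom_on G B Y) (i2 : hom_on B G Y) :=
  forall V (VY : V `<=` Y) s,
    s = ho_app i1 VY (ho_app p1 VY s) + ho_app i2 VY (ho_app p2 VY s).

Lemma god_map_splits G A B (p1 : hom_on G A Y) i1 (p2 : hom_on G B Y) i2 :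
  splits p1 i1 p2 i2 ->
  splits (god_map p1) (god_map i1) (god_map p2) (god_map i2).
Proof.
move=> sp V VY t; apply: disc_ext => x Vx.
have addE (a b : god G V) : (a + b) x Vx = a x Vx + b x Vx by [].
rewrite addE /=; have [U [UV [Ux [s ->]]]] := stalk_germ_in Vx (t x Vx).
have UY := subset_trans UV VY.
rewrite (stalk_mapE p1 _ UY) (stalk_mapE p2 _ UY) (stalk_mapE i1 _ UY).
by rewrite (stalk_mapE i2 _ UY) [in LHS](sp _ UY s) raddfD.
Qed.

Lemma godQ_map_splits G A B (p1 : hom_on G A Y) i1 (p2 : hom_on G B Y) i2 :
  splits p1 i1 p2 i2 ->
  splits (godQ_map p1) (godQ_map i1) (godQ_map p2) (godQ_map i2).
Proof.
move=> sp V VY c; have [t <-] := piQ_surj c.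
rewrite (godQ_map_pi p1 VY t) (godQ_map_pi p2 VY t).
by rewrite (godQ_map_pi i1) (godQ_map_pi i2) -raddfD -(god_map_splits sp).
Qed.

Definition Qn n F := iter n (@godQ X) F.

Fixpoint Qn_map n F G (f : hom_on F G Y) : hom_on (Qn n F) (Qn n G) Y :=
  if n is m.+1 then godQ_map (Qn_map m f) else f.

Lemma Qn_map_id_on W n F (f : hom_on F F Y) : id_on W f -> id_on W (Qn_map n f).
Proof. by move=> fid; elim: n => //= n; exact: godQ_map_id_on. Qed.

Lemma Qn_map_zero_on W n F G (f : hom_on F G Y) :
  zero_on W f -> zero_on W (Qn_map n f).
Proof. by move=> f0; elim: n => //= n; exact: godQ_map_zero_on. Qed.

Lemma Qn_map_comp_zero n F G A (f : hom_on F G Y) (g : hom_on G A Y) :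
  comp_zero f g -> comp_zero (Qn_map n f) (Qn_map n g).
Proof. by move=> gf; elim: n => //= n; exact: godQ_map_comp_zero. Qed.

Lemma Qn_map_splits n G A B (p1 : hom_on G A Y) i1 (p2 : hom_on G B Y) i2 :
  splits p1 i1 p2 i2 ->
  splits (Qn_map n p1) (Qn_map n i1) (Qn_map n p2) (Qn_map n i2).
Proof. by move=> sp; elim: n => //= n; exact: godQ_map_splits. Qed.

(* The Godement rows [G -> god G -> god (godQ G) -> ...] are exact on [Y]. *)
Record acyclic G : Prop := Acyclic {
  acyclic_inj : forall s : G Y, eta G Y s = 0 -> s = 0;
  acyclic_eta : forall t : god G Y, delta G Y t = 0 -> exists s, eta G Y s = t;
  acyclic_delta : forall n (t : god (Qn n.+1 G) Y),
    delta (Qn n.+1 G) Y t = 0 -> exists s, delta (Qn n G) Y s = t }.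

(** Project a cycle to [A] and [B], solve there, and recombine the two solutions with [i1] and [i2];
    all four maps act on the whole rows and commute with [delta]. *)
Lemma acyclic_splits G A B (p1 : hom_on G A Y) i1 (p2 : hom_on G B Y) i2 :
  splits p1 i1 p2 i2 -> acyclic A -> acyclic B -> acyclic G.
Proof.
move=> sp aA aB; pose YY := @subset_refl _ (Y : set X).
split=> [s s0|t t0|n t t0].
- rewrite (sp _ YY s); have pz C (p : hom_on G C Y) :
      eta C Y (ho_app p YY s) = 0 by rewrite -god_map_eta s0 raddf0.
  by rewrite (acyclic_inj aA (pz _ p1)) (acyclic_inj aB (pz _ p2)) !raddf0 addr0.
- have pz C (p : hom_on G C Y) : delta C Y (ho_app (god_map p) YY t) = 0.
    by rewrite -delta_god_map t0 raddf0.
  have [a aE] := acyclic_eta aA (pz _ p1); have [b bE] := acyclic_eta aB (pz _ p2).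
  exists (ho_app i1 YY a + ho_app i2 YY b).
  by rewrite raddfD -!god_map_eta aE bE -(god_map_splits sp).
- have pz C (p : hom_on G C Y) :
      delta (Qn n.+1 C) Y (ho_app (god_map (Qn_map n.+1 p)) YY t) = 0.
    rewrite -(delta_god_map (Qn_map n.+1 p)) t0.
    exact: raddf0.
  have [a aE] := acyclic_delta aA (pz _ p1).
  have [b bE] := acyclic_delta aB (pz _ p2).
  exists (ho_app (god_map (Qn_map n i1)) YY a + ho_app (god_map (Qn_map n i2)) YY b).
  rewrite raddfD -(delta_god_map (Qn_map n i1)) -(delta_god_map (Qn_map n i2)).
  by rewrite aE bE; exact/esym/(god_map_splits (Qn_map_splits (n := n.+1) sp)).
Qed.

End HomOn.

(** * Godement rows of flabby sheaves *)

Section Flabby.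
Context (X : topologicalType).
Implicit Types (U V W Z : opens X).

(** Sections of a presheaf cokernel lift over every open set, so their extension is inherited from
    [god F]. *)
Lemma godQ_flabby (F : presheaf X) : flabby (godQ F).
Proof.
move=> U c; have [t <-] := piQ_surj c.
have [t' <-] := god_flabby t; exists (piQ F _ t').
by rewrite -hom_nat.
Qed.

Section GodQSheaf.
Context (F : presheaf X) (sF : is_sheaf F) (fF : flabby F).

Lemma godQ_locally_eq0 (U : opens X) (c : godQ F U) :
  locally_on (fun (V : opens X) (VU : V `<=` U) => res (godQ F) VU c = 0) -> c = 0.
Proof.
have [t <-] := piQ_surj c => t0.
apply/hom_pi_eq0; apply: eta_glue => // x /t0[V [VU [Vx]]].
by rewrite -hom_nat => /hom_pi_eq0 e; exists V, VU.
Qed.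

Record partial_lift (U : opens X) := PartialLift {
  pl_dom : opens X;
  pl_sub : pl_dom `<=` U;
  pl_sec : god F pl_dom }.

Arguments pl_dom {U} p : rename.
Arguments pl_sub {U} p : rename.
Arguments pl_sec {U} p : rename.

(** Existence is the vanishing of the first cohomology of a flabby sheaf, by Zorn on lifts of the
    family [s] to [god F] over parts of [U]. A maximal lift over [W] must have [V i] inside [W] for
    each [i], since otherwise it could be glued with a suitable lift of [s i]. *)
Lemma godQ_is_sheaf : is_sheaf (godQ F).
Proof.
move=> U I V VU UV s sV.
have uniq (t t' : godQ F U) : (forall i, res (godQ F) (VU i) t = s i) ->
    (forall i, res (godQ F) (VU i) t' = s i) -> t = t'.
  move=> tP t'P; apply/eqP; rewrite -subr_eq0; apply/eqP/godQ_locally_eq0.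
  move=> x /UV[i _ Vx]; exists (V i), (VU i); split=> //.
  by rewrite raddfB tP t'P subrr.
suff [t tP] : exists t, forall i, res (godQ F) (VU i) t = s i.
  by exists t; split=> // t' t'P; exact: uniq.
pose good (p : partial_lift U) := forall i,
  res (godQ F) (@opensIl _ (pl_dom p) (V i)) (piQ F _ (pl_sec p)) =
  res (godQ F) (@opensIr _ (pl_dom p) (V i)) (s i).
pose T := {p | good p}.
pose le (p q : T) := `[< exists pq : pl_dom (sval p) `<=` pl_dom (sval q),
  res (god F) pq (pl_sec (sval q)) = pl_sec (sval p) >].
have open0' : open (set0 : set X) by exact: open0.
pose e0 : opens X := Opens open0'.
have e0U : e0 `<=` U by [].
have good0 : good (@PartialLift U e0 e0U 0).
  move=> i; apply/eqP; rewrite -subr_eq0; apply/eqP/godQ_locally_eq0.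
  by move=> x [].
have [||C Ctot|m mP] := @ZL_preorder T (exist _ _ good0) le.
- move=> p; apply/asboolP; exists (@subset_refl _ _); exact: res_id.
- move=> q p r /asboolP[pq pqE] /asboolP[qr qrE]; apply/asboolP.
  by exists (subset_trans pq qr); rewrite -(res_comp qr pq) qrE.
- have openC : open (\bigcup_(p in C) (pl_dom (sval p) : set X)).
    by apply: bigcup_open => p _; exact: opensP.
  pose W : opens X := Opens openC.
  have CW p : C p -> pl_dom (sval p) `<=` W by move=> Cp x px; exists p.
  have compat p q (Z : opens X) (Zp : Z `<=` pl_dom (sval p))
      (Zq : Z `<=` pl_dom (sval q)) : C p -> C q ->
      res (god F) Zp (pl_sec (sval p)) = res (god F) Zq (pl_sec (sval q)).
    move=> Cp Cq; have [/asboolP[pq <-]|/asboolP[pq <-]] := Ctot p q Cp Cq.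
      exact: res_comp.
    by rewrite (res_comp _ _ Zp).
  pose P (Z : opens X) (ZW : Z `<=` W) (t : god F Z) := exists p (_ : C p)
    (Zp : Z `<=` pl_dom (sval p)), res (god F) Zp (pl_sec (sval p)) = t.
  have [| |x [p Cp px]|t tP] := @sheaf_glue X (god F) (@god_is_sheaf X F) W P.
  + move=> Z Z' ZW Z'Z Z'W t [p [Cp [Zp <-]]].
    by exists p, Cp, (subset_trans Z'Z Zp); rewrite (res_comp _ _ (subset_trans Z'Z Zp)).
  + by move=> Z ZW t t' [p [Cp [Zp <-]]] [q [Cq [Zq <-]]]; exact: compat.
  + exists (pl_dom (sval p)), (CW p Cp); split=> //.
    by exists (pl_sec (sval p)), p, Cp, (@subset_refl _ _); rewrite res_id.
  have WU : W `<=` U by move=> x [p _ px]; exact: (pl_sub (sval p) _ px).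
  have tE p (Cp : C p) : res (god F) (CW p Cp) t = pl_sec (sval p).
    by apply: tP; exists p, Cp, (@subset_refl _ _); rewrite res_id.
  have goodt : good (@PartialLift U W WU t).
    move=> i; rewrite [pl_dom _]/= [pl_sec _]/=.
    apply/eqP; rewrite -subr_eq0; apply/eqP/godQ_locally_eq0.
    move=> x [[p Cp px] Vx].
    have ZI : opensI (pl_dom (sval p)) (V i) `<=` opensI W (V i).
      by move=> y [yp yV]; split=> //; exact: (CW p Cp).
    exists (opensI (pl_dom (sval p)) (V i)), ZI; split=> //.
    rewrite raddfB.
    rewrite (res_comp _ _ (subset_trans (@opensIl _ _ _) (CW p Cp))).
    rewrite (res_comp _ _ (@opensIr _ (pl_dom (sval p)) (V i))).
    rewrite -(svalP p i) -(res_comp (CW p Cp) (@opensIl _ _ _)).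
    by rewrite -(hom_nat (piQ F)) tE subrr.
  by exists (exist _ _ goodt) => p Cp; apply/asboolP; exists (CW p Cp).
case: m mP => -[W WU t] gt mP.
have tP i : res (godQ F) (@opensIl _ W (V i)) (piQ F W t) =
    res (godQ F) (@opensIr _ W (V i)) (s i) := gt i.
suff UW : U `<=` W.
  exists (piQ F U (res (god F) UW t)) => i.
  have VW := subset_trans (VU i) UW.
  have VI : V i `<=` opensI W (V i) by move=> x Vx; split=> //; exact: VW.
  rewrite -hom_nat (res_comp _ _ VW) hom_nat.
  rewrite -(res_comp (@opensIl _ W (V i)) VI VW) tP (res_comp _ _ (@subset_refl _ _)).
  exact: res_id.
move=> x /UV[i _ Vx].
have [ti tiE] := piQ_surj (s i).
have [g gE] : exists g, eta F (opensI W (V i)) g =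
    res (god F) (@opensIl _ W (V i)) t - res (god F) (@opensIr _ W (V i)) ti.
  apply/(hom_pi_eq (eta F)); have := tP i; rewrite -tiE.
  by rewrite -(hom_nat (piQ F) _ t) -(hom_nat (piQ F) _ ti).
(* Flabbiness enters here: the discrepancy [g] of the two lifts is a section of [F] over the overlap
   only. Extended to [X], it corrects the lift of [s i] on all of [V i] without changing its
   class. *)
have [g' g'E] := fF g.
pose ti' := ti + eta F (V i) (res F (@subopensT X (V i)) g').
have ti'E : piQ F (V i) ti' = s i.
  rewrite raddfD tiE -[RHS]addr0; congr (_ + _).
  by apply/(hom_pi_eq0 (eta F)); eexists.
have agree : res (god F) (@opensIl _ W (V i)) t = res (god F) (@opensIr _ W (V i)) ti'.
  rewrite raddfD -hom_nat (res_comp _ _ (@subopensT X _)) g'E gE.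
  by rewrite addrC subrK.
have openWV : open ((W : set X) `|` V i) by apply: openU; exact: opensP.
pose WV : opens X := Opens openWV.
have WVU : WV `<=` U by move=> y [/WU//|/(VU i)].
have WsWV : W `<=` WV by move=> y; left.
have VsWV : V i `<=` WV by move=> y; right.
pose P (Z : opens X) (ZW : Z `<=` WV) (u : god F Z) :=
  (exists ZW : Z `<=` W, u = res (god F) ZW t) \/
  (exists ZV : Z `<=` V i, u = res (god F) ZV ti').
have [| |y|u uP] := @sheaf_glue X (god F) (@god_is_sheaf X F) WV P.
- move=> Z Z' ZW Z'Z Z'W u [[Zs ->]|[Zs ->]]; [left|right];
    by exists (subset_trans Z'Z Zs); rewrite (res_comp _ _ (subset_trans Z'Z Zs)).
- have key (Z : opens X) (ZW : Z `<=` W) (ZV : Z `<=` V i) :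
      res (god F) ZW t = res (god F) ZV ti'.
    have ZI : Z `<=` opensI W (V i) by move=> y Zy; split; [exact: ZW|exact: ZV].
    by rewrite -(res_comp (@opensIl _ W (V i)) ZI) agree (res_comp _ _ ZV).
  move=> Z ZW u u' [[Zs ->]|[Zs ->]] [[Zs' ->]|[Zs' ->]] //.
  + by rewrite (Prop_irrelevance Zs Zs').
  + exact: key.
  + by symmetry; apply: key.
  + by rewrite (Prop_irrelevance Zs Zs').
- move=> [Wy|Vy].
    by exists W, WsWV; split=> //; exists t; left; exists (@subset_refl _ _); rewrite res_id.
  exists (V i), VsWV; split=> //; exists ti'; right; exists (@subset_refl _ _).
  by rewrite res_id.
have uW : res (god F) WsWV u = t.
  by apply: uP; left; exists (@subset_refl _ _); rewrite res_id.
have uV : res (god F) VsWV u = ti'.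
  by apply: uP; right; exists (@subset_refl _ _); rewrite res_id.
have goodu : good (@PartialLift U WV WVU u).
  move=> j; rewrite [pl_dom _]/= [pl_sec _]/=.
  apply/eqP; rewrite -subr_eq0; apply/eqP/godQ_locally_eq0.
  move=> y [[Wy|Vy] Vjy].
    have ZI : opensI W (V j) `<=` opensI WV (V j).
      by move=> z [Wz Vz]; split=> //; left.
    exists (opensI W (V j)), ZI; split=> //.
    rewrite raddfB (res_comp _ _ (subset_trans (@opensIl _ _ _) WsWV)).
    rewrite (res_comp _ _ (@opensIr _ W (V j))) -tP.
    rewrite -(res_comp WsWV (@opensIl _ _ _)).
    by rewrite -(hom_nat (piQ F)) uW subrr.
  have ZI : opensI (V i) (V j) `<=` opensI WV (V j).
    by move=> z [Wz Vz]; split=> //; right.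
  exists (opensI (V i) (V j)), ZI; split=> //.
  rewrite raddfB (res_comp _ _ (subset_trans (@opensIl _ _ _) VsWV)).
  rewrite (res_comp _ _ (@opensIr _ (V i) (V j))).
  rewrite -(sV i j _ (@opensIl _ _ _) (@opensIr _ _ _)) -ti'E.
  rewrite -(res_comp VsWV (@opensIl _ _ _)).
  by rewrite -(hom_nat (piQ F)) uV subrr.
have /asboolP[+ _] : le (exist _ _ goodu) (exist _ (PartialLift WU t) gt).
  by apply: mP; apply/asboolP; exists WsWV.
by apply; right.
Qed.

End GodQSheaf.

(** Every [Qn n F] is again a flabby sheaf, so [eta_glue] applies at each place of the rows; what it
    produces lifts along the surjective [piQ]. *)
Lemma acyclic_flabby (F : presheaf X) (Y : opens X) :
  is_sheaf F -> flabby F -> acyclic Y F.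
Proof.
move=> sF fF.
have Qsf n : is_sheaf (Qn n F) /\ flabby (Qn n F).
  by elim: n => // n [sn fn]; split; [exact: godQ_is_sheaf|exact: godQ_flabby].
split=> [s|t /delta_eq0|n t /delta_eq0].
- exact: eta_inj.
- exact: eta_glue.
- move=> /eta_glue[]; first exact: (Qsf n.+1).1.
  move=> s <-; have [w <-] := piQ_surj s; by exists w.
Qed.

End Flabby.

(** * Sections of exact complexes of acyclic presheaves *)

Section ExactComplexes.
Context (X : topologicalType) (Y : opens X).
Implicit Types (U V W : opens X).

(** Only zero is a boundary in degree 0, so [locally_exact] includes the local injectivity of
    [d 0]. *)
Definition is_bd (E : nat -> presheaf X) (d : forall n, hom_on (E n) (E n.+1) Y)
    n V (VY : V `<=` Y) : E n V -> Prop :=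
  match n with
  | 0 => fun s => s = 0
  | m.+1 => fun s => exists t, ho_app (d m) VY t = s
  end.

Definition locally_exact (E : nat -> presheaf X)
    (d : forall n, hom_on (E n) (E n.+1) Y) : Prop :=
  forall n V (VY : V `<=` Y) (s : E n V), ho_app (d n) VY s = 0 ->
    locally_on (fun W (WV : W `<=` V) =>
      is_bd d (subset_trans WV VY) (res (E n) WV s)).

Section Step.
Context (E : nat -> presheaf X) (d : forall n, hom_on (E n) (E n.+1) Y).
Hypothesis dd : forall n, comp_zero (d n) (d n.+1).
Hypothesis dE : locally_exact d.

(** Local exactness is exactness on stalks, and a section of [god] is an arbitrary family of germs,
    so preimages may be chosen point by point. *)
Lemma god_exact n V (VY : V `<=` Y) (t : god (E n) V) :
  ho_app (god_map (d n)) VY t = 0 ->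
  is_bd (fun n => god_map (d n)) VY t.
Proof.
move=> dt0.
have germ_bd x (Vx : os V x) : exists U (UY : U `<=` Y) (Ux : os U x) (s : E n U),
    t x Vx = germ Ux s /\ is_bd d UY s.
  have [U [UV [Ux [s sE]]]] := stalk_germ_in Vx (t x Vx).
  have UY := subset_trans UV VY.
  have : germ Ux (ho_app (d n) UY s) = 0.
    rewrite -(stalk_mapE (d n) (VY x Vx)) -sE.
    exact: (congr1 (fun u : disc (E n.+1) V => u x Vx) dt0).
  move=> /germ_eq0[W [WU [Wx]]]; have WY := subset_trans WU UY.
  rewrite -(ho_nat _ _ _ WY) => /dE/(_ x Wx)[W' [W'W [W'x bd]]].
  exists W', (subset_trans W'W WY), W'x, (res (E n) W'W (res (E n) WU s)).
  by split=> //; rewrite sE (germ_res _ _ Wx) germ_res.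
case: n t dt0 germ_bd => [|n] t dt0 germ_bd /=.
  apply: disc_ext => x Vx; have [U [UY [Ux [s [-> ->]]]]] := germ_bd x Vx.
  by rewrite raddf0.
have ex x (Vx : os V x) : exists w, stalk_map (d n) (VY x Vx) w = t x Vx.
  have [U [UY [Ux [s [-> [w <-]]]]]] := germ_bd x Vx.
  by exists (germ Ux w); rewrite (stalk_mapE _ _ UY).
exists (fun x Vx => projT1 (cid (ex x Vx))); apply: disc_ext => x Vx /=.
exact: (projT2 (cid (ex x Vx))).
Qed.

(** The long exact sequence argument for [E], [god E], [godQ E]. If [t] represents a cycle, then
    [d t = eta e] and [d e] is locally zero; locally [e = d b], and [t - eta b] is a cycle of [god]
    with the same class as [t], hence a boundary. *)
Lemma godQ_locally_exact : locally_exact (fun n => godQ_map (d n)).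
Proof.
move=> n V VY c; have [t <-] := piQ_surj c.
rewrite godQ_map_pi => /(hom_pi_eq0 (eta _))[e eE] x Vx.
have : eta _ V (ho_app (d n.+1) VY e) = 0.
  by rewrite -god_map_eta eE; exact: god_map_comp_zero.
move=> /eta_eq0/(_ x Vx)[W [WV [Wx]]]; have WY := subset_trans WV VY.
rewrite -(ho_nat _ _ _ WY) => /dE/(_ x Wx)[W' [W'W [W'x [b bE]]]].
have W'V := subset_trans W'W WV; have W'Y := subset_trans W'V VY.
exists W', W'V; split=> //.
have : ho_app (god_map (d n)) W'Y (res (god (E n)) W'V t - eta (E n) W' b) = 0.
  rewrite (ho_app_additive (god_map (d n))) (ho_nat _ VY) -eE god_map_eta -(hom_nat (eta _)).
  rewrite (Prop_irrelevance W'Y (subset_trans W'W WY)) bE.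
  by rewrite (res_comp _ _ W'V) subrr.
move=> /god_exact; rewrite (Prop_irrelevance (subset_trans W'V VY) W'Y).
have piE : piQ (E n) W' (res (god (E n)) W'V t - eta (E n) W' b) =
    res (godQ (E n)) W'V (piQ (E n) V t).
  rewrite raddfB -hom_nat -[RHS]subr0; congr (_ - _).
  by apply/(hom_pi_eq0 (eta _)); exists b.
rewrite -piE; move: (res _ W'V t - _) => u.
case: {c t e eE b bE piE} n u => [|n] u; first by move=> /= ->; rewrite raddf0.
by move=> [w wE]; exists (piQ _ W' w); rewrite godQ_map_pi wE.
Qed.

End Step.

Section Sections.
Context (E : nat -> presheaf X) (d : forall n, hom_on (E n) (E n.+1) Y).
Hypothesis dd : forall n, comp_zero (d n) (d n.+1).
Hypothesis dE : locally_exact d.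
Hypothesis acE : forall n, acyclic Y (E n).

Let YY := @subset_refl _ (Y : set X).

Lemma Qn_locally_exact p : locally_exact (fun n => Qn_map p (d n)).
Proof.
elim: p => //= p IHp; apply: godQ_locally_exact => // n.
exact: Qn_map_comp_zero.
Qed.

(* The chase along an antidiagonal of the double complex [god (Qn p (E m))]. *)
Lemma row_descent m p (z : god (Qn p.+1 (E m)) Y) :
  delta (Qn p.+1 (E m)) Y z = 0 ->
  ho_app (god_map (Qn_map p.+1 (d m))) YY z = 0 ->
  exists2 w : god (Qn p (E m)) Y, delta (Qn p (E m)) Y w = z
    & ho_app (god_map (Qn_map p (d m))) YY w = 0.
Proof.
elim: m p z => [|m IHm] p z dz0 z0.
  have -> : z = 0 := god_exact (@Qn_locally_exact p.+1) z0.
  by exists 0; exact: raddf0.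
have [y yE] : exists y, ho_app (god_map (Qn_map p.+1 (d m))) YY y = z.
  by have := god_exact (@Qn_locally_exact p.+1) z0.
(* [delta y] is closed in both directions, one degree lower in [E] and one Godement step further.
   The [w] obtained from it makes [y - w] a [delta]-cycle, thus [delta v], and [d v] is the required
   element because [d w = 0]. *)
have [||w wE w0] := IHm p.+1 (delta (Qn p.+1 (E m)) Y y).
- exact: delta_delta.
- by rewrite (delta_god_map (Qn_map p.+1 (d m))) yE.
have [|v vE] := acyclic_delta (acE m) (t := y - w).
  have -> : delta (Qn p.+1 (E m)) Y (y - w) =
      delta (Qn p.+1 (E m)) Y y - delta (Qn p.+1 (E m)) Y w.
    exact: raddfB.
  rewrite wE.
  exact: subrr.
exists (ho_app (god_map (Qn_map p (d m))) YY v).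
  rewrite -(delta_god_map (Qn_map p (d m))) vE.
  by rewrite (ho_app_additive (god_map (Qn_map p.+1 (d m)))) w0 subr0.
by apply: god_map_comp_zero; exact: Qn_map_comp_zero.
Qed.

(** In [god] the section [eta s] is a boundary [d y]. The element [delta y] is closed in both
    directions, so [row_descent] gives a [d]-cycle [w] with [delta w = delta y]; then [y - w] comes
    from [E] and is the primitive sought. *)
Lemma acyclic_exact n (s : E n Y) : ho_app (d n) YY s = 0 -> is_bd d YY s.
Proof.
move=> ds0.
have es0 : ho_app (god_map (d n)) YY (eta (E n) Y s) = 0.
  by rewrite god_map_eta ds0 raddf0.
case: n s ds0 es0 => [|n] s ds0 es0 /=.
  by apply: (acyclic_inj (acE 0)); exact: (god_exact dE es0).
have [y yE] : exists y, ho_app (god_map (d n)) YY y = eta (E n.+1) Y s.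
  by have := god_exact dE es0.
have [||w wE w0] := @row_descent n 0 (delta (E n) Y y).
- exact: delta_delta.
- by rewrite (delta_god_map (d n)) yE delta_eta.
have [|t tE] := acyclic_eta (acE n) (t := y - w).
  by rewrite raddfB wE subrr.
exists t; apply/eqP; rewrite -subr_eq0; apply/eqP/(acyclic_inj (acE n.+1)).
rewrite raddfB -god_map_eta tE (ho_app_additive (god_map (d n))) w0 subr0 yE.
exact: subrr.
Qed.

End Sections.

End ExactComplexes.

(** * Complexes and resolutions of presheaves *)

Section PresheafComplexes.
Context (X : topologicalType).
Implicit Types (U V W : opens X).

Record psh_complex := PshComplex {
  pc_obj :> nat -> presheaf X;
  pc_d : forall q, sheaf_hom (pc_obj q) (pc_obj q.+1);
  pc_dd : forall q U (s : pc_obj q U), pc_d q.+1 U (pc_d q U s) = 0 }.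

Definition psh_of (K : sheaf_complex X) : psh_complex :=
  @PshComplex (fun q => K q) (sc_d K) (@sc_dd X K).

Context (S : sheaf X).

(** Unlike in [is_bd], the image of the augmentation counts as boundaries in degree 0, so that one
    exactness statement covers all degrees of a resolution. *)
Definition aug_bd (M : psh_complex) (i : sheaf_hom S (M 0%N)) n U :
    M n U -> Prop :=
  match n with
  | 0 => fun s => exists t, i U t = s
  | m.+1 => fun s => exists t, pc_d M m U t = s
  end.

Lemma aug_bd_res (M : psh_complex) (i : sheaf_hom S (M 0%N)) n U V
    (VU : V `<=` U) (s : M n U) :
  aug_bd i s -> aug_bd i (res (M n) VU s).
Proof.
by case: n s => [|n] s [t <-]; exists (res _ VU t); rewrite hom_nat.
Qed.

(* Resolutions by presheaves, exactness being that of the associated sheaves. *)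
Record psh_resolution (M : psh_complex) (i : sheaf_hom S (M 0%N)) : Prop :=
  PshResolution {
    pr_inj : forall U (s : S U), i U s = 0 -> s = 0;
    pr_d0 : forall U (s : S U), pc_d M 0 U (i U s) = 0;
    pr_exact : forall n U (s : M n U), pc_d M n U s = 0 ->
      locally_on (fun V (VU : V `<=` U) => aug_bd i (res (M n) VU s)) }.

Lemma resolution_psh (K : sheaf_complex X) (i : sheaf_hom S (K 0%N)) :
  is_resolution i -> @psh_resolution (psh_of K) i.
Proof.
move=> [inj ex0 exS]; split.
- by move=> U s s0; apply: (inj U); rewrite s0 raddf0.
- move=> U s; apply/ex0 => x Ux; exists U, (@subset_refl _ _); split=> //.
  by exists s; rewrite res_id.
- by move=> [|n] U s; [move/ex0|move/exS].
Qed.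

Lemma psh_resolution_sheaf (K : sheaf_complex X) (i : sheaf_hom S (K 0%N)) :
  @psh_resolution (psh_of K) i -> is_resolution i.
Proof.
move=> [inj d0 ex]; split.
- move=> U s t st; apply/eqP; rewrite -subr_eq0; apply/eqP/inj.
  by rewrite raddfB st subrr.
- move=> U s; split=> [/(ex 0%N)//|loc].
  apply: (sheaf_locally_eq0 (@sheafP _ (K 1%N))) => x /loc[V [VU [Vx [t tE]]]].
  by exists V, VU; split=> //; rewrite -hom_nat -tE d0.
- move=> q U s; split=> [/(ex q.+1)//|loc].
  apply: (sheaf_locally_eq0 (@sheafP _ (K q.+2))) => x /loc[V [VU [Vx [t tE]]]].
  by exists V, VU; split=> //; rewrite -hom_nat -tE sc_dd.
Qed.

End PresheafComplexes.

(** * The cone of a morphism of resolutions *)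

Section Cone.
Context (X : topologicalType) (S : sheaf X) (K L : sheaf_complex X).
Context (iK : sheaf_hom S (K 0%N)) (iL : sheaf_hom S (L 0%N)).
Context (a : complex_hom K L).
Hypothesis resK : is_resolution iK.
Hypothesis resL : is_resolution iL.
Hypothesis ia : resolution_hom iK iL a.

Definition prev_psh n : presheaf X :=
  match n with 0 => psh_zero X | m.+1 => L m end.

Definition prev_psh_d n : sheaf_hom (prev_psh n) (L n) :=
  match n with 0 => hom_zero (psh_zero X) (L 0%N) | m.+1 => sc_d L m end.

Definition cone_psh n := psh_prod (K n) (prev_psh n).

(** Same sign convention as [rel_d], with [a] in the place of the restriction to [X']. *)
Definition cone_d n : sheaf_hom (cone_psh n) (cone_psh n.+1) :=
  @hom_pair X (K n.+1) (L n) (cone_psh n)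
    (hom_comp (sc_d K n) (hom_fst _ _))
    (hom_copair (a n) (hom_opp (prev_psh_d n))).

Lemma cone_dE n U (k : K n U) (l : prev_psh n U) :
  cone_d n U (k, l) = (sc_d K n U k, a n U k - prev_psh_d n U l).
Proof. by []. Qed.

Lemma cone_dd n U (c : cone_psh n U) : cone_d n.+1 U (cone_d n U c) = 0.
Proof.
case: c => k l; rewrite cone_dE [LHS]cone_dE sc_dd ch_comm /= raddfB.
have -> : sc_d L n U (prev_psh_d n U l) = 0.
  by case: n k l => [|n] k l /=; rewrite ?raddf0 ?sc_dd.
by rewrite subr0 subrr.
Qed.

Context (Y : opens X).

(** Locally [k = d k'], and then [l - a k'] is a cycle of [L], locally a boundary. The two lowest
    degrees differ because there the role of boundaries is played by [S]. *)
Lemma cone_locally_exact : locally_exact (fun n => ho_of Y (cone_d n)).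
Proof.
have rK := resolution_psh resK; have rL := resolution_psh resL.
move=> n V VY [k l] /=; rewrite -/(cone_d n V (k, l)) cone_dE => -[dk0 akl] x Vx.
have {akl} akl : a n V k = prev_psh_d n V l by apply/eqP; rewrite -subr_eq0 akl.
have [W [WV [Wx bd]]] := pr_exact rK dk0 Vx.
case: n k l dk0 akl bd => [|n] k l dk0 akl /= [k' k'E].
  exists W, WV; split=> //; congr pair; last exact: psh_zero_eq.
  suff k'0 : k' = 0 by rewrite -k'E k'0 raddf0.
  by apply: (pr_inj rL); rewrite -ia k'E hom_nat akl raddf0.
have : sc_d L n W (res (L n) WV l - a n W k') = 0.
  by rewrite raddfB hom_nat -akl -hom_nat -k'E ch_comm subrr.
move=> /(pr_exact rL)/(_ x Wx)[T [TW [Tx]]].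
rewrite raddfB (res_comp _ _ (subset_trans TW WV)) -hom_nat => bd.
exists T, (subset_trans TW WV); split=> //.
have dk' : sc_d K n T (res (K n) TW k') = res (K n.+1) (subset_trans TW WV) k.
  by rewrite hom_nat k'E (res_comp _ _ (subset_trans TW WV)).
case: n k l k' k'E dk0 akl dk' bd => [|n] k l k' k'E dk0 akl dk' /= [u uE].
  (* In degree 1 the cycle [l - a k'] equals [iL u]; it is absorbed by adding [iK u] to [k'], as [a]
     carries [iK] to [iL] and [d] kills [iK u]. *)
  exists (res (K 0%N) TW k' + iK T u, tt); rewrite -/(cone_d 0 T _) cone_dE.
  rewrite !raddfD dk' (pr_d0 rK) addr0 ia uE /= subr0.
  by congr pair; rewrite addrC subrK.
exists (res (K n.+1) TW k', - u); rewrite -/(cone_d n.+1 T _) cone_dE dk' /=.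
by congr pair; rewrite raddfN opprK uE addrC subrK.
Qed.

Hypothesis acK : forall n, acyclic Y (K n).
Hypothesis flL : forall n, flabby (L n).

Lemma psh_zero_acyclic : acyclic Y (psh_zero X).
Proof.
apply: acyclic_flabby; last by move=> U s; exists 0; exact: psh_zero_eq.
move=> U I V VU UV s _; exists 0; split=> [i|t _]; exact: psh_zero_eq.
Qed.

Lemma cone_acyclic n : acyclic Y (cone_psh n).
Proof.
apply: (@acyclic_splits X Y (cone_psh n) (K n) (prev_psh n)
    (ho_of Y (hom_fst _ _)) (ho_of Y (hom_inl _ _))
    (ho_of Y (hom_snd _ _)) (ho_of Y (hom_inr _ _))) => //.
- by move=> V VY [k l]; congr pair; rewrite /= ?addr0 ?add0r.
- case: n => [|n]; first exact: psh_zero_acyclic.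
  exact: acyclic_flabby (@sheafP _ (L n)) (@flL n).
Qed.

Lemma cone_exact n (c : cone_psh n Y) : cone_d n Y c = 0 ->
  is_bd (fun n => ho_of Y (cone_d n)) (@subset_refl _ Y) c.
Proof.
apply: (@acyclic_exact _ _ _ (fun n => ho_of Y (cone_d n))).
- by move=> m V VY s; exact: cone_dd.
- exact: cone_locally_exact.
- exact: cone_acyclic.
Qed.

Lemma cone_exact0 (k : K 0%N Y) : sc_d K 0 Y k = 0 -> a 0%N Y k = 0 -> k = 0.
Proof.
move=> dk0 ak0.
have ce : cone_d 0 Y ((k, tt) : cone_psh 0 Y) = 0.
  by rewrite cone_dE dk0 ak0 /= subr0.
exact: (congr1 fst (cone_exact ce : (k, tt) = 0 :> cone_psh 0 Y)).
Qed.

(** Both halves of the comparison over [Y] in one statement: the case [k = 0] is surjectivity of [a]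
    on cohomology in degree [n], and the existence of [k'] is injectivity in degree [n.+1]. *)
Lemma cone_exactS n (k : K n.+1 Y) (l : L n Y) :
  sc_d K n.+1 Y k = 0 -> a n.+1 Y k = sc_d L n Y l ->
  exists (k' : K n Y) (l' : prev_sec Y L n),
    sc_d K n Y k' = k /\ l = a n Y k' - prev_d Y L n l'.
Proof.
move=> dk0 akl.
have ce : cone_d n.+1 Y ((k, l) : cone_psh n.+1 Y) = 0.
  by rewrite cone_dE dk0 akl /= subrr.
have [[k' l']] : exists c, cone_d n Y c = (k, l) := cone_exact ce.
rewrite cone_dE => -[dk' lE].
clear ce dk0 akl.
by case: n k l k' l' dk' lE => [|n] k l k' l' dk' lE;
  exists k', l'.
Qed.

End Cone.

(** * Locally finite covers and their closed shrinkings *)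

Section Paracompact.
Context (T : topologicalType).

Definition locally_finite (W : set (set T)) : Prop :=
  forall x : T, exists2 N : set T, nbhs x N &
    finite_set [set v | W v /\ N `&` v !=set0].

(** Near a given point only finitely many members matter, and a finite union of closed sets is
    closed. *)
Lemma closed_locally_finite (W A : set (set T)) :
  locally_finite W -> A `<=` W -> closed (\bigcup_(v in A) closure v).
Proof.
move=> lfW AW x xcl.
have [N Nx finN] := lfW x.
(* The interior of [N] is taken because an open set that meets [closure v] also meets [v]. *)
pose B := [set v | A v /\ N° `&` v !=set0].
have finB : finite_set B.
  apply: sub_finite_set finN => v [Av [y [Ny vy]]]; split; first exact: AW.
  by exists y; split=> //; exact: interior_subset.
have clB : closed (\bigcup_(v in B) closure v).
  by apply: closed_bigcup => // v _; exact: closed_closure.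
apply: contrapT => nx.
have nB : nbhs x (~` (\bigcup_(v in B) closure v)).
  apply: open_nbhs_nbhs; split; first exact: closed_openC.
  by move=> [v [Av _] vx]; apply: nx; exists v.
have [z [[v Av vz] [Nz nBz]]] := xcl _ (filterI (nbhs_interior Nx) nB).
apply: nBz; exists v => //; split=> //.
have [y [vy Ny]] := vz _ (open_nbhs_nbhs (conj (open_interior N) Nz)).
by exists y.
Qed.

Hypothesis pT : paracompact T.

(** The opens that lie in [b] or have closure away from [x] form a cover by the Hausdorff property.
    In a locally finite refinement, remove the closures of all members whose closure misses [x]. A
    point outside [b] has such a member as a neighbourhood, and this member is disjoint from what
    remains. *)
Lemma paracompact_regular (x : T) (b : set T) : open b -> b x ->
  exists w : set T, [/\ open w, w x & closure w `<=` b].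
Proof.
move=> ob bx; have [hT ref] := pT.
pose U := [set u : set T | open u /\ (~ closure u x \/ u `<=` b)].
have [u [ou _]//||V [oV covV VU lfV]] := ref U.
  apply/seteqP; split=> // y _.
  have [<-|/eqP xy] := pselect (x = y).
    by exists b => //; split=> //; right.
  move: hT; rewrite open_hausdorff => /(_ _ _ xy)[[A B] /= [+ +] [oA oB AB0]].
  rewrite !inE => Ax By; exists B => //; split=> //; left => /(_ A) [].
    exact: open_nbhs_nbhs.
  move=> z [Bz Az]; move/eqP/seteqP: AB0 => [/(_ z)AB _]; exact: AB.
pose D := [set v | V v /\ ~ closure v x].
have clD : closed (\bigcup_(v in D) closure v).
  by apply: closed_locally_finite lfV _ => v [].
exists (~` \bigcup_(v in D) closure v); split.
- exact: closed_openC.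
- by move=> [v [_ vx]].
move=> y ycl; apply: contrapT => by_.
have [v Vv vy] : (\bigcup_(v in V) v) y by rewrite covV.
have Dv : D v.
  split=> //; have [u [ou [nux|ub]] vu] := VU v Vv; last by case: by_; apply/ub/vu.
  by apply: contra_not nux; exact: closure_subset.
have [z [/= nz vz]] := ycl v (open_nbhs_nbhs (conj (oV v Vv) vy)).
by apply: nz; exists v => //; exact: subset_closure.
Qed.

(** By regularity, the opens with closure inside a member of [O] cover the space. [V b] is the union
    of the closures, inside [b], of the members of a locally finite refinement of that cover, hence
    closed. *)
Lemma paracompact_shrink (U : set (set T)) :
  (forall u, U u -> open u) -> \bigcup_(u in U) u = setT ->
  exists (O : set (set T)) (V : set T -> set T),
    [/\ forall b, O b -> open b, forall b, O b -> exists2 u, U u & b `<=` u,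
        forall b, closed (V b) /\ (O b -> V b `<=` b),
        forall x, exists2 b, O b & V b x
      & locally_finite O].
Proof.
move=> oU covU; have [hT ref] := pT.
have [O [oO covO OU lfO]] := ref U oU covU.
pose R := [set w | open w /\ exists2 b, O b & closure w `<=` b].
have [w []//||W [oW covW WR lfW]] := ref R.
  apply/seteqP; split=> // x _.
  have [b Ob bx] : (\bigcup_(v in O) v) x by rewrite covO.
  have [w [ow wx wb]] := paracompact_regular (oO b Ob) bx.
  by exists w => //; split=> //; exists b.
pose V b := \bigcup_(w in [set w | W w /\ closure w `<=` b]) closure w.
exists O, V; split=> //.
- move=> b; split; last by move=> _ x [w [_ +] wx]; exact.
  by apply: closed_locally_finite lfW _ => w [].
- move=> x; have [w Ww wx] : (\bigcup_(w in W) w) x by rewrite covW.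
  have [u [_ [b Ob ub]] wu] := WR w Ww.
  exists b => //; exists w; last exact: subset_closure.
  by split=> //; exact: subset_trans (closure_subset wu) ub.
Qed.

End Paracompact.

(** * Shrinkings over an open subset *)

Section Shrinkable.
Context (X : topologicalType) (Y : opens X).
Implicit Types (U V W Z : opens X).

(** All data are subsets of [X], the [C i] being closed relative to [Y], so that the whole space and
    the subspace [X'] are treated alike. *)
Record shrinking (I : Type) (O : I -> opens X) (C : I -> set X) : Prop :=
  Shrinking {
    shr_dom : forall i, O i `<=` Y;
    shr_sub : forall i, C i `<=` O i;
    shr_closed : forall i, open ((Y : set X) `\` C i);
    shr_cover : forall x, os Y x -> exists i, C i x;
    shr_finite : forall x, os Y x -> exists2 N : opens X, os N x &
      finite_set [set i | (N : set X) `&` O i !=set0] }.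

Arguments shr_dom {I O C} _ i : rename.
Arguments shr_sub {I O C} _ i : rename.

Definition shrinkable : Prop :=
  forall P : opens X -> Prop,
    (forall V W, W `<=` V -> P V -> P W) -> (forall V, V `<=` set0 -> P V) ->
    locally_on (fun V (VY : V `<=` Y) => P V) ->
  exists (I : choiceType) (O : I -> opens X) (C : I -> set X),
    shrinking O C /\ forall i, P (O i).

Context (T : topologicalType) (e : T -> X).
Hypothesis einj : injective e.
Hypothesis eopen : forall B, open B -> open (e @` B).
Hypothesis econt : forall A, open A -> open (e @^-1` A).
Hypothesis eY : range e = Y.

Lemma shrinkable_embedding : paracompact T -> shrinkable.
Proof.
move=> pT P Psub P0 Ploc.
pose U := [set u : set T | exists2 V : opens X, V `<=` Y /\ P V & u = e @^-1` V].
have [u [V _ ->]||O [C [oO OU clC covC lfO]]] := @paracompact_shrink T pT U.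
- by apply: econt; exact: opensP.
- apply/seteqP; split=> // t _.
  have Yt : os Y (e t) by rewrite -eY; exists t.
  have [V [VY [Vt PV]]] := Ploc _ Yt.
  by exists (e @^-1` V) => //; exists V.
(* The index type will be all of [set T]: indices outside [O] receive the empty open, which is why
   [shrinkable] asks [P] of empty opens. *)
have oO' b : open [set x | O b /\ (e @` b) x].
  have [Ob|nOb] := pselect (O b).
    suff -> : [set x | O b /\ (e @` b) x] = e @` b by apply/eopen/oO.
    by apply/seteqP; split=> [x []|x bx].
  suff -> : [set x | O b /\ (e @` b) x] = set0 by exact: open0.
  by apply/seteqP; split=> x []//.
exists (set T : choiceType), (fun b => Opens (oO' b)).
exists (fun b => [set x | O b /\ (e @` C b) x]); split; last first.
  move=> b; have [Ob|nOb] := pselect (O b); last by apply: P0 => x [].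
  have [u [V [VY PV] ->] bV] := OU b Ob.
  by apply: Psub PV => x [_ [t bt <-]]; exact: bV.
split=> /=.
- by move=> b x [_ [t _ <-]]; rewrite -eY; exists t.
- by move=> b x [Ob [t Ct <-]]; split=> //; exists t => //; exact: (clC b).2.
- move=> b; have [Ob|nOb] := pselect (O b).
    suff -> : (Y : set X) `\` [set x | O b /\ (e @` C b) x] = e @` (~` C b).
      by apply/eopen/closed_openC/(clC b).1.
    rewrite -eY; apply/seteqP; split=> [x [[t _ <-] nC]|_ [t nC <-]].
      by exists t => // Ct; apply: nC; split=> //; exists t.
    by split; [exists t|move=> [_ [t' Ct' /einj tt']]; apply: nC; rewrite -tt'].
  suff -> : (Y : set X) `\` [set x | O b /\ (e @` C b) x] = Y by exact: opensP.
  by apply/seteqP; split=> [x []//|x Yx]; split=> // -[].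
- by move=> x; rewrite -eY => -[t _ <-]; have [b Ob Cb] := covC t;
    exists b; split=> //; exists t.
- move=> x; rewrite -eY => -[t _ <-]; have [N Nt finN] := lfO t.
  exists (Opens (eopen (open_interior N))) => /=; first by exists t.
  apply: sub_finite_set finN => b [_ [[t' Nt' <-] [Ob [t'' bt'' /einj tt]]]].
  split=> //; exists t'; split; first exact: interior_subset.
  by rewrite -tt.
Qed.

End Shrinkable.

Arguments shr_dom {X Y I O C} _ i : rename.
Arguments shr_sub {X Y I O C} _ i : rename.


(** * Patching local lifts with bump endomorphisms *)

Section FineLift.
Context (X : topologicalType) (Y : opens X) (A B : presheaf X).
Context (f : sheaf_hom A B).
Implicit Types (U V W Z : opens X).

Definition near_point (x : X) (P : forall W, W `<=` Y -> Prop) : Prop :=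
  exists W (WY : W `<=` Y), os W x /\ P W WY.

(** Vanishing is asked on [A], where a section is to be extended by zero, and the identity on [B],
    where the equation to be solved lives. *)
Definition has_bumps : Prop := forall (O : opens X) (C : set X),
  O `<=` Y -> C `<=` O -> open ((Y : set X) `\` C) ->
  exists (phiA : hom_on A A Y) (phiB : hom_on B B Y),
  [/\ forall V (VY : V `<=` Y) s, f V (ho_app phiA VY s) = ho_app phiB VY (f V s),
      forall x, C x -> near_point x (fun W _ => id_on W phiB)
    & forall x, os Y x -> ~ os O x -> near_point x (fun W _ => zero_on W phiA)].

Hypothesis sA : is_sheaf A.
Hypothesis sB : is_sheaf B.
Hypothesis bumps : has_bumps.

Section Zorn.
Context (I : choiceType) (O : I -> opens X) (C : I -> set X).
Hypothesis shr : shrinking Y O C.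
Context (s : B Y).
Hypothesis lift : forall i, exists u : A (O i), f (O i) u = res B (shr_dom shr i) s.

Definition partial_solution := (set I * A Y)%type.

Definition solves (p : partial_solution) := forall i x, p.1 i -> C i x ->
  near_point x (fun W WY => res B WY (s - f Y p.2) = 0).

(* Local finiteness of [O] makes chains for this order locally stationary. *)
Definition refines (p q : partial_solution) : Prop := p.1 `<=` q.1 /\
  forall W (WY : W `<=` Y),
    (forall i, q.1 i -> (W : set X) `&` O i !=set0 -> p.1 i) ->
    res A WY p.2 = res A WY q.2.

Lemma refines_refl p : refines p p. Proof. by split. Qed.

Lemma refines_trans p q r : refines p q -> refines q r -> refines p r.
Proof.
move=> [pq pqE] [qr qrE]; split; first exact: subset_trans pq qr.
move=> W WY H; rewrite (pqE W WY); last by move=> i qi; apply/H/qr.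
by apply: qrE => i ri WO; apply/pq/H.
Qed.

(** Indices are added one at a time; of two members of a chain, the larger retains the indices of
    the smaller. *)
Lemma finite_chain (F : set partial_solution) (c0 : partial_solution)
    (D : set I) : total_on F refines -> F c0 -> finite_set D ->
  exists2 c, F c & forall i, D i -> (exists2 c', F c' & c'.1 i) -> c.1 i.
Proof.
move=> Ftot Fc0 /finite_seqP[l ->]; elim: l => [|i l [c Fc cP]].
  by exists c0 => // i; rewrite /= in_nil.
have [[c' Fc' c'i]|ni] := pselect (exists2 c', F c' & c'.1 i); last first.
  by exists c => // j /=; rewrite inE => /orP[/eqP->//|]; exact: cP.
have [[cc' _]|[c'c _]] := Ftot c c' Fc Fc'.
  exists c' => // j /=; rewrite inE => /orP[/eqP->//|jl] ex.
  by apply: cc'; exact: cP.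
exists c => // j /=; rewrite inE => /orP[/eqP-> _|]; last exact: cP.
exact: c'c.
Qed.

(** Near each point only finitely many [O i] matter, so by [finite_chain] one member of the chain
    contains every relevant index. From that member on, the sections no longer change near the
    point, and the stationary values glue. *)
Lemma chain_bound (F : set partial_solution) (c0 : partial_solution) :
  total_on F refines -> F c0 -> (forall c, F c -> solves c) ->
  exists2 p, solves p & forall c, F c -> refines c p.
Proof.
move=> Ftot Fc0 Fs.
pose J := [set i | exists2 c, F c & c.1 i].
pose complete (c : partial_solution) Z : Prop := forall i, J i -> (Z : set X) `&` O i !=set0 -> c.1 i.
have localP x : os Y x -> exists Z (ZY : Z `<=` Y), os Z x /\
    exists2 c, F c & complete c Z.
  move=> Yx; have [N Nx finN] := shr_finite shr Yx.
  have [c Fc cP] := finite_chain Ftot Fc0 finN.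
  exists (opensI N Y), (@opensIr _ _ _); split=> //; exists c => // i Ji.
  by move=> [y [[Ny _] Oy]]; apply: cP => //; exists y.
pose P Z (ZY : Z `<=` Y) (u : A Z) :=
  exists2 c, F c & complete c Z /\ res A ZY c.2 = u.
have [| |x Yx|t tP] := @sheaf_glue X A sA Y P.
- move=> V W VY WV WY u [c Fc [cV <-]]; exists c => //; split.
    by move=> i Ji [y [Wy Oy]]; apply: cV => //; exists y; split=> //; exact: WV.
  by rewrite (res_comp _ _ WY).
- move=> V VY u u' [c Fc [cV <-]] [c' Fc' [cV' <-]].
  have [[_ cc']|[_ c'c]] := Ftot c c' Fc Fc'.
    by apply: cc' => i ci; apply: cV; exists c'.
  by symmetry; apply: c'c => i ci; apply: cV'; exists c.
- have [Z [ZY [Zx [c Fc cZ]]]] := localP x Yx.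
  by exists Z, ZY; split=> //; exists (res A ZY c.2), c.
exists (J, t).
- move=> i x /= [c' Fc' c'i] Cx; have Ox := shr_sub shr i x Cx.
  have [Z [ZY [Zx [c Fc cZ]]]] := localP x (shr_dom shr i x Ox).
  have ci : c.1 i by apply: cZ; [exists c'|exists x].
  have [W [WY [Wx W0]]] := Fs c Fc i x ci Cx.
  have IY : opensI Z W `<=` Y by move=> y [/ZY].
  exists (opensI Z W), IY; split=> //.
  rewrite raddfB -hom_nat -(res_comp ZY (@opensIl _ Z W) IY t).
  have -> : res A ZY t = res A ZY c.2 by apply: tP; exists c.
  rewrite (res_comp _ _ IY) hom_nat -raddfB.
  by rewrite -(res_comp WY (@opensIr _ Z W)) W0 raddf0.
- move=> c Fc; split; first by move=> i ci; exists c.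
  by move=> W WY cW; symmetry; apply: tP; exists c.
Qed.

(** With [u] a lift over [O i] and [y = u - t] there, let [v] be [phiA y] extended by zero. Then
    [f v = phiB (s - f t)] on [O i]: this stays zero wherever [t] was already a solution, and equals
    [s - f t] near [C i], so [t + v] also solves there. *)
Lemma solution_extend (p : partial_solution) i : solves p ->
  exists2 q, solves q & refines p q /\ q.1 i.
Proof.
case: p => J t /= solJ.
have [Ji|nJi] := pselect (J i).
  by exists (J, t) => //; split=> //; exact: refines_refl.
have [u uE] := lift i.
pose OY : O i `<=` Y := shr_dom shr i.
have [phiA [phiB [fphi phiC phiO]]] :=
  bumps OY (shr_sub shr i) (shr_closed shr i).
pose y := u - res A OY t.
have fy Z (ZO : Z `<=` O i) (ZY : Z `<=` Y) :
    f Z (res A ZO y) = res B ZY (s - f Y t).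
  rewrite hom_nat; have -> : f (O i) y = res B OY (s - f Y t).
    by rewrite /y 2!raddfB uE hom_nat.
  by rewrite (res_comp _ _ ZY).
(* The two clauses describe [v] inside [O i] and where [phiA] vanishes; on a common open they agree
   since [phiA y] is zero there. *)
pose P Z (ZY : Z `<=` Y) (w : A Z) :=
  (exists ZO : Z `<=` O i, w = ho_app phiA ZY (res A ZO y)) \/
  (w = 0 /\ zero_on Z phiA).
have [| |x Yx|v vP] := @sheaf_glue X A sA Y P.
- move=> V W VY WV WY w [[VO ->]|[-> z]]; [left|right].
    exists (subset_trans WV VO).
    by rewrite -(ho_nat _ VY WV WY) (res_comp _ _ (subset_trans WV VO)).
  rewrite raddf0; split=> // Z ZY w' ZW; apply: z; exact: subset_trans ZW WV.
- move=> V VY w w' [[VO ->]|[-> z]] [[VO' ->]|[-> z']] //.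
  + by rewrite (Prop_irrelevance VO VO').
  + exact: z'.
  + by symmetry; apply: z.
- have [Ox|nOx] := pselect (os (O i) x).
    exists (O i), OY; split=> //; exists (ho_app phiA OY y); left.
    by exists (@subset_refl _ _); rewrite res_id.
  have [W [WY [Wx z]]] := phiO x Yx nOx.
  by exists W, WY; split=> //; exists 0; right.
have vO Z (ZO : Z `<=` O i) (ZY : Z `<=` Y) :
    res A ZY v = ho_app phiA ZY (res A ZO y).
  by apply: vP; left; exists ZO.
have v0 Z (ZY : Z `<=` Y) : zero_on Z phiA -> res A ZY v = 0.
  by move=> z; apply: vP; right.
have resE Z (ZY : Z `<=` Y) : res B ZY (s - f Y (t + v)) =
    res B ZY (s - f Y t) - f Z (res A ZY v).
  by rewrite (raddfD (f Y)) opprD addrA (raddfB (res B ZY)) hom_nat.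
exists (J `|` [set i], t + v).
  move=> j x /= [Jj|->] Cx.
    have [W [WY [Wx W0]]] := solJ j x Jj Cx.
    have [Ox|nOx] := pselect (os (O i) x).
      have IY : opensI W (O i) `<=` Y by move=> z [/WY].
      exists (opensI W (O i)), IY; split=> //.
      rewrite resE.
      rewrite (vO _ (@opensIr _ W (O i))) fphi (fy _ _ IY).
      by rewrite -(res_comp WY (@opensIl _ W (O i)) IY) W0 !raddf0 addr0.
    have [W' [W'Y [W'x z]]] := phiO x (WY x Wx) nOx.
    have IY : opensI W W' `<=` Y by move=> y' [/WY].
    exists (opensI W W'), IY; split=> //.
    rewrite resE v0; last first.
      by move=> V VY w VI; apply: z; exact: subset_trans VI (@opensIr _ _ _).
    by rewrite -(res_comp WY (@opensIl _ W W') IY) W0 !raddf0 addr0.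
  have [W [WY [Wx idW]]] := phiC x Cx.
  have IY : opensI W (O i) `<=` Y by move=> z [/WY].
  exists (opensI W (O i)), IY; split=> //; first by split=> //; exact: shr_sub shr i x Cx.
  rewrite resE.
  rewrite (vO _ (@opensIr _ W (O i))) fphi (fy _ _ IY).
  by rewrite idW ?subrr//; exact: opensIl.
split; last by right.
split; first by move=> j; left.
move=> W WY /= H.
rewrite raddfD; suff -> : res A WY v = 0 by rewrite addr0.
apply: (sheaf_locally_eq0 sA) => x Wx.
have nOx : ~ os (O i) x by move=> Ox; apply/nJi/H; [right|exists x].
have [W' [W'Y [W'x z]]] := phiO x (WY x Wx) nOx.
exists (opensI W W'), (@opensIl _ W W'); split=> //.
rewrite (res_comp _ _ (subset_trans (@opensIl _ W W') WY)) v0//.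
by move=> V VY w VI; apply: z; exact: subset_trans VI (@opensIr _ _ _).
Qed.

Lemma shrinking_lift : exists t, f Y t = s.
Proof.
pose T := {p | solves p}.
pose le (p q : T) := `[< refines (sval p) (sval q) >].
have sol0 : solves (set0, 0) by [].
have [p|p q r /asboolP pq /asboolP qr|F Ftot|[[J t] sol] mP] :=
  @ZL_preorder T (exist _ _ sol0) le.
- by apply/asboolP; exact: refines_refl.
- by apply/asboolP; exact: refines_trans qr.
- have [[c0 Fc0]|F0] := pselect (exists c, F c); last first.
    by exists (exist _ _ sol0) => c Fc; case: F0; exists c.
  have [||_ [c _ <-]|p solp pP] := @chain_bound (sval @` F) (sval c0) _ _ _.
  + by move=> _ _ [c Fc <-] [d Fd <-]; have [/asboolP|/asboolP] := Ftot c d Fc Fd;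
      [left|right].
  + by exists c0.
  + exact: svalP.
  exists (exist _ p solp) => c Fc; apply/asboolP; apply: pP; by exists c.
have Jall i : J i.
  have [q solq [Jq qi]] := solution_extend i sol.
  have /asboolP[+ _] : le (exist _ q solq) (exist _ (J, t) sol).
    by apply: mP; apply/asboolP.
  by apply.
exists t; apply/eqP; rewrite -subr_eq0 -oppr_eq0 opprB; apply/eqP.
apply: (sheaf_locally_eq0 sB) => x /(shr_cover shr)[i Cx].
exact: sol (Jall i) Cx.
Qed.

End Zorn.

Lemma fine_lift (s : B Y) : shrinkable Y ->
  locally_on (fun V (VY : V `<=` Y) => exists u, f V u = res B VY s) ->
  exists t, f Y t = s.
Proof.
move=> shY loc.
pose P V := exists (VY : V `<=` Y) (u : A V), f V u = res B VY s.
have [V W WV [VY [u uE]]|V V0|x /loc[V [VY [Vx ex]]]|I [O [C [shr PO]]]] := shY P.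
- exists (subset_trans WV VY), (res A WV u).
  by rewrite hom_nat uE (res_comp _ _ (subset_trans WV VY)).
(* Over an empty open any two sections of the sheaf [B] agree, so 0 is a lift. *)
- exists (subset_trans V0 (@sub0set _ _)), 0.
  by apply: (sheaf_locally_eq sB) => x /V0.
- by exists V, VY; split=> //; exists VY.
apply: (shrinking_lift (shr := shr)) => i; have [OY [u uE]] := PO i.
by exists u; rewrite uE (Prop_irrelevance OY (shr_dom shr i)).
Qed.

End FineLift.

(** * Fine sheaves have exact Godement rows *)

Section FineAcyclic.
Context (X : topologicalType) (Y : opens X) (G : presheaf X).
Implicit Types (U V W Z : opens X).

Definition bumpable : Prop := forall (O : opens X) (C : set X),
  O `<=` Y -> C `<=` O -> open ((Y : set X) `\` C) ->
  exists phi : hom_on G G Y,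
    (forall x, C x -> near_point x (fun W (_ : W `<=` Y) => id_on W phi)) /\
    (forall x, os Y x -> ~ os O x -> near_point x (fun W (_ : W `<=` Y) => zero_on W phi)).

(** A [delta]-cycle is locally a [delta]-image because [piQ] is surjective on sections, and
    [fine_lift] patches the local preimages. Both endomorphisms that it requires are induced by one
    [phi] of [G], which makes them commute with [delta]. *)
Lemma acyclic_fine : is_sheaf G -> shrinkable Y -> bumpable -> acyclic Y G.
Proof.
move=> sG shY bump; split=> [s|t /delta_eq0|n t /delta_eq0 loc].
- exact: eta_inj.
- exact: eta_glue.
apply: (fine_lift (@god_is_sheaf _ _) (@god_is_sheaf _ _) _ shY).
  move=> O C OY CO oC; have [phi [phiC phiO]] := bump O C OY CO oC.
  exists (god_map (Qn_map n phi)), (god_map (Qn_map n.+1 phi)); split.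
  - by move=> V VY s; rewrite -(delta_god_map (Qn_map n phi)).
  - move=> x /phiC[W [WY [Wx idW]]]; exists W, WY; split=> //.
    by apply: god_map_id_on; exact: (Qn_map_id_on (n := n.+1)).
  - move=> x Yx /(phiO x Yx)[W [WY [Wx zW]]]; exists W, WY; split=> //.
    by apply: god_map_zero_on; exact: (Qn_map_zero_on (n := n)).
move=> x /loc[V [VY [Vx [c cE]]]]; exists V, VY; split=> //.
by have [w wE] := piQ_surj c; exists w; rewrite -cE -wE.
Qed.

End FineAcyclic.

Section Bumps.
Context (X : topologicalType) (G : sheaf X).
Implicit Types (U V W Z : opens X).

Definition ho_id U : hom_on G G U := ho_of U (hom_id G).

(** Softness of the endomorphism sheaf is applied to the union of [C] and the complement of [O].
    These closed sets are disjoint, so the identity on one and zero on the other form a section over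
    the union. Equality of germs with the extension then spreads to neighbourhoods. *)
Lemma fine_bumpable : fine G -> bumpable (opensT X) G.
Proof.
move=> fG O C _ CO oC; pose H := hom_sheaf G G.
pose A : set X := C `|` ~` O.
have oC' : open (~` C) by suff <- : (opensT X : set X) `\` C = ~` C by [];
  apply/seteqP; split=> x // -[].
have clA : closed A.
  apply: closedU; first by rewrite -[C]setCK; exact: open_closedC.
  exact/open_closedC/opensP.
pose TX (x : X) : os (opensT X) x := Logic.I.
pose sx (x : X) : stalk H x :=
  germ (TX x)
    (if pselect (C x) then ho_id (opensT X) : H (opensT X) else 0).
have cont (x : A) : exists U (t : H U), os U (val x) /\
    forall (y : A) (Uy : os U (val y)), sx (val y) = germ Uy t.
  have [Cx|nCx] := pselect (C (val x)).
    (* A point of [A] that lies in [O] lies in [C], so the identity over [O] represents the section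
       near [C]; zero over the complement of [C] serves the other points. *)
    exists O, (res H (@subopensT X O) (ho_id (opensT X))).
    split=> [|y Oy]; first exact: CO.
    rewrite (germ_res _ _ (TX _)) /sx; case: pselect => // nCy.
    by case: (set_valP y).
  exists (Opens oC'), 0; split=> // y nCy; rewrite /sx; case: pselect => // ?.
  by rewrite !raddf0.
have [t tE] := fG A clA (SectionsOver cont).
have tg x : A x -> germ (TX x) t = sx x.
  move=> Ax.
  exact: (congr1 (fun s : sections_over H A => s (SigSub (mem_set Ax))) tE).
exists t; split=> [x Cx|x _ nOx].
  have := tg x (or_introl Cx); rewrite /sx; case: pselect => // ?.
  move=> /germ_eq[W [WX [WX' [Wx e]]]]; exists W, WX; split=> // V VY s VW.
  have /= := congr1 (fun h : hom_on G G W => ho_app h VW s) e.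
  by rewrite (Prop_irrelevance (subset_trans VW WX) VY).
have := tg x (or_intror nOx); rewrite /sx; case: pselect => [/CO//|?].
rewrite raddf0 => /germ_eq0[W [WX [Wx e]]]; exists W, WX; split=> // V VY s VW.
have /= := congr1 (fun h : hom_on G G W => ho_app h VW s) e.
by rewrite (Prop_irrelevance (subset_trans VW WX) VY).
Qed.

End Bumps.

(** * Bump endomorphisms coming from the subspace *)

Section BumpsRestr.
Context (X : topologicalType) (X' : opens X) (G : sheaf X).
Implicit Types (U V W Z : opens X).

Lemma open_of_subK V : V `<=` X' -> V `<=` open_of_sub (sub_of_open X' V).
Proof. by move=> VX x Vx; exists (SigSub (mem_set (VX x Vx))). Qed.

Lemma sub_of_opensub V : open_of_sub (sub_of_open X' V) `<=` V.
Proof. by move=> _ [y Vy <-]. Qed.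

Lemma sub_of_open_mono V W : W `<=` V -> sub_of_open X' W `<=` sub_of_open X' V.
Proof. by move=> WV x; exact: WV. Qed.

Local Notation G' := (sheaf_restr X' G).

Section Extend.
Context (phi : hom_on G' G' (opensT _)).

(** [V] and [open_of_sub (sub_of_open X' V)] have the same points without being convertible, hence
    the restrictions on both sides. *)
Definition ho_extend_app V (VX : V `<=` X') (s : G V) : G V :=
  res G (open_of_subK VX)
    (ho_app phi (@subopensT _ (sub_of_open X' V)) (res G (@sub_of_opensub V) s)).

Definition ho_extend : hom_on G G X'.
Proof.
refine (@HomOn X G G X' ho_extend_app _ _).
  by move=> V VX s t; rewrite /ho_extend_app !raddfD.
move=> V W VX WV WX s; rewrite /ho_extend_app.
have mono := sub_of_open_mono WV.
have -> : res G (@sub_of_opensub W) (res G WV s) =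
    res G' mono (res G (@sub_of_opensub V) s).
  have WW : open_of_sub (sub_of_open X' W) `<=` V.
    exact: subset_trans (@sub_of_opensub W) WV.
  by rewrite (res_comp _ _ WW) /= (res_comp _ _ WW).
rewrite (ho_nat phi (@subopensT _ (sub_of_open X' V)) mono) /=.
have WV' : W `<=` open_of_sub (sub_of_open X' V).
  exact: subset_trans WV (open_of_subK VX).
by rewrite (res_comp _ _ WV') (res_comp _ _ WV').
Defined.

Lemma ho_extend_id_on (W : opens X') : id_on W phi ->
  id_on (open_of_sub W) ho_extend.
Proof.
move=> fid V VX s VW; rewrite /= /ho_extend_app fid ?resK//.
by move=> x Vx; have [y Wy /val_inj <-] := VW _ Vx.
Qed.

Lemma ho_extend_zero_on (W : opens X') : zero_on W phi ->
  zero_on (open_of_sub W) ho_extend.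
Proof.
move=> f0 V VX s VW; rewrite /= /ho_extend_app f0 ?raddf0//.
by move=> x Vx; have [y Wy /val_inj <-] := VW _ Vx.
Qed.

End Extend.

Lemma fine_restr_bumpable : fine G' -> bumpable X' G.
Proof.
move=> fG O C OX CO oC.
have [|||phi [phiC phiO]] :=
    @fine_bumpable _ G' fG (sub_of_open X' O) (set_val @^-1` C).
- by [].
- by move=> x; exact: CO.
- suff -> : (opensT X' : set X') `\` set_val @^-1` C =
      sub_of_open X' (Opens oC) by exact: opensP.
  apply/seteqP; split=> x /= [] // _ nCx; split=> //; exact: set_valP.
have open_of_subX (W : opens X') : open_of_sub W `<=` X'.
  by move=> _ [y _ <-]; exact: set_valP.
exists (ho_extend phi); split.
- move=> x Cx; have Xx := OX _ (CO _ Cx).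
  have [W [_ [Wx idW]]] := phiC (SigSub (mem_set Xx)) Cx.
  exists (open_of_sub W), (open_of_subX W); split; last exact: ho_extend_id_on.
  by exists (SigSub (mem_set Xx)).
- move=> x Xx nOx.
  have [W [_ [Wx zW]]] := phiO (SigSub (mem_set Xx)) Logic.I nOx.
  exists (open_of_sub W), (open_of_subX W); split; last exact: ho_extend_zero_on.
  by exists (SigSub (mem_set Xx)).
Qed.

End BumpsRestr.

Section FineAcyclic.
Context (X : topologicalType).

Lemma fine_acyclic (G : sheaf X) : paracompact X -> fine G ->
  acyclic (opensT X) G.
Proof.
move=> pX fG; apply: acyclic_fine; [exact: sheafP| |exact: fine_bumpable].
apply: (@shrinkable_embedding X (opensT X) X idfun) => //.
- by move=> B; rewrite image_id.
- by apply/seteqP; split=> x // _; exists x.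
Qed.

Lemma fine_restr_acyclic (X' : opens X) (G : sheaf X) :
  paracompact (set_type X') -> fine (sheaf_restr X' G) -> acyclic X' G.
Proof.
move=> pX fG; apply: acyclic_fine; [exact: sheafP| |exact: fine_restr_bumpable].
apply: (@shrinkable_embedding X X' (set_type X') set_val) => //.
- by move=> B oB; exact: (opensP (open_of_sub (Opens oB))).
- by move=> A oA; exact: (opensP (sub_of_open X' (Opens oA))).
- apply/seteqP; split=> [_ [y _ <-]|x Xx]; first exact: set_valP.
  by exists (SigSub (mem_set Xx)).
Qed.

End FineAcyclic.

(** * Morphisms of presheaf complexes *)

Section PshHom.
Context (X : topologicalType).
Implicit Types (U V W : opens X).

Record psh_hom (M N : psh_complex X) := PshHom {
  ph_app :> forall q, sheaf_hom (M q) (N q);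
  ph_comm : forall q U (s : M q U),
    ph_app q.+1 U (pc_d M q U s) = pc_d N q U (ph_app q U s) }.

Definition locally_injective (M N : psh_complex X) (f : psh_hom M N) :=
  forall q U (s : M q U), f q U s = 0 ->
    locally_on (fun V (VU : V `<=` U) => res (M q) VU s = 0).

Definition psh_hom_of (K L : sheaf_complex X) (a : complex_hom K L) :
  psh_hom (psh_of K) (psh_of L) :=
  @PshHom (psh_of K) (psh_of L) (ch_app a) (@ch_comm X K L a).

Definition to_complex_hom (K L : sheaf_complex X)
    (f : psh_hom (psh_of K) (psh_of L)) : complex_hom K L :=
  @ComplexHom X K L (ph_app f) (@ph_comm _ _ f).

Definition ph_comp (M N P : psh_complex X) (g : psh_hom N P) (f : psh_hom M N) :
  psh_hom M P.
Proof.
by refine (@PshHom M P (fun q => hom_comp (g q) (f q)) _) => q U s /=;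
  rewrite !ph_comm.
Defined.

End PshHom.

(** * A flabby resolution receiving a given presheaf resolution *)

Section FlabbyTarget.
Context (X : topologicalType) (M : psh_complex X).
Implicit Types (U V W : opens X).

(* The objects [P_n] of the recursion [P_0 = M_0] and
   [P_{n+1} = (god P_n + M_{n+1}) / P_n], with their maps [M_n -> P_n -> M_{n+1}];
   the complex [god P_n] is then a flabby resolution receiving [M]. *)
Record stage n := Stage {
  st_P : presheaf X;
  st_k : sheaf_hom (M n) st_P;
  st_e : sheaf_hom st_P (M n.+1);
  st_ek : forall U (s : M n U), st_e U (st_k U s) = pc_d M n U s;
  st_de : forall U (p : st_P U), pc_d M n.+1 U (st_e U p) = 0 }.

Definition stage0 : stage 0 :=
  @Stage 0 (M 0%N) (hom_id (M 0%N)) (pc_d M 0) (fun U s => erefl) (@pc_dd X M 0).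

Section Step.
Context (n : nat) (st : stage n).

Definition st_glue : sheaf_hom (st_P st) (psh_prod (god (st_P st)) (M n.+1)) :=
  hom_pair (eta (st_P st)) (hom_opp (st_e st)).

Definition step_P := psh_coker st_glue.

Definition step_k : sheaf_hom (M n.+1) step_P :=
  hom_comp (hom_pi st_glue) (hom_inr _ _).

Lemma step_e_subproof U (p : st_P st U) :
  hom_comp (pc_d M n.+1) (hom_snd _ _) U (st_glue U p) = 0.
Proof. by rewrite /= raddfN st_de oppr0. Qed.

Definition step_e : sheaf_hom step_P (M n.+2) := hom_lift step_e_subproof.

Lemma step_eE U t m : step_e U (hom_pi st_glue U (t, m)) = pc_d M n.+1 U m.
Proof. exact: hom_liftE. Qed.

Lemma step_ek U (s : M n.+1 U) : step_e U (step_k U s) = pc_d M n.+1 U s.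
Proof. exact: step_eE. Qed.

Lemma step_de U (p : step_P U) : pc_d M n.+2 U (step_e U p) = 0.
Proof.
by have [[t m] <-] := hom_pi_surj p; rewrite step_eE pc_dd.
Qed.

Definition step : stage n.+1 := Stage step_ek step_de.

End Step.

Fixpoint stages n : stage n :=
  match n with 0 => stage0 | m.+1 => step (stages m) end.

Definition flP n := st_P (stages n).
Definition fl_k n : sheaf_hom (M n) (flP n) := st_k (stages n).
Definition fl_e n : sheaf_hom (flP n) (M n.+1) := st_e (stages n).
Definition fl_glue n : sheaf_hom (flP n) (psh_prod (god (flP n)) (M n.+1)) :=
  st_glue (stages n).
Definition fl_pi n : sheaf_hom (psh_prod (god (flP n)) (M n.+1)) (flP n.+1) :=
  hom_pi (fl_glue n).

Lemma fl_glueE n U (p : flP n U) :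
  fl_glue n U p = (eta (flP n) U p, - fl_e n U p).
Proof. by []. Qed.

Lemma fl_pi_eq0 n U c : fl_pi n U c = 0 <-> exists p, fl_glue n U p = c.
Proof. exact: hom_pi_eq0. Qed.

Lemma fl_pi_eq n U c c' : (exists p, fl_glue n U p = c - c') ->
  fl_pi n U c = fl_pi n U c'.
Proof. by move=> ?; apply/hom_pi_eq. Qed.

Lemma fl_pi_surj n U (p : flP n.+1 U) : exists t m, fl_pi n U (t, m) = p.
Proof. by have [[t m] <-] := hom_pi_surj p; exists t, m. Qed.

Lemma fl_ek n U (s : M n U) : fl_e n U (fl_k n U s) = pc_d M n U s.
Proof. exact: st_ek. Qed.

Lemma fl_kS n U (s : M n.+1 U) : fl_k n.+1 U s = fl_pi n U (0, s).
Proof. by []. Qed.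

Lemma fl_ekS n U t m : fl_e n.+1 U (fl_pi n U (t, m)) = pc_d M n.+1 U m.
Proof. exact: step_eE. Qed.

Definition fl_d n : sheaf_hom (god (flP n)) (god (flP n.+1)) :=
  hom_comp (eta (flP n.+1)) (hom_comp (fl_pi n) (hom_inl _ _)).

Lemma fl_dE n U t : fl_d n U t = eta (flP n.+1) U (fl_pi n U (t, 0)).
Proof. by []. Qed.

Lemma fl_dd n U (t : god (flP n) U) : fl_d n.+1 U (fl_d n U t) = 0.
Proof.
rewrite fl_dE; suff -> : fl_pi n.+1 U (fl_d n U t, 0) = 0 by exact: raddf0.
apply/fl_pi_eq0; exists (fl_pi n U (t, 0)).
by rewrite fl_glueE fl_ekS raddf0 oppr0.
Qed.

Definition flabby_complex : sheaf_complex X :=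
  @SheafComplex X (fun n => god_sheaf (flP n)) fl_d fl_dd.

Lemma flabby_complex_flabby n : flabby (flabby_complex n).
Proof. exact: god_flabby. Qed.

Definition fl_j n : sheaf_hom (M n) (god (flP n)) :=
  hom_comp (eta (flP n)) (fl_k n).

Lemma fl_jE n U s : fl_j n U s = eta (flP n) U (fl_k n U s).
Proof. by []. Qed.

(** The pushout identifies [(eta p, 0)] with [(0, fl_e p)]; here [p = fl_k s]. This gives the
    compatibility of [fl_j] with the differentials and the primitives in [flabby_resolution]. *)
Lemma fl_pi_j n U (s : M n U) t :
  fl_pi n U (t + fl_j n U s, 0) = fl_pi n U (t, pc_d M n U s).
Proof.
apply: fl_pi_eq; exists (fl_k n U s); rewrite fl_glueE fl_ek.
by congr pair; rewrite ?sub0r//= addrC addKr.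
Qed.

Lemma fl_j_comm n U (s : M n U) :
  fl_j n.+1 U (pc_d M n U s) = fl_d n U (fl_j n U s).
Proof. by rewrite fl_jE fl_dE fl_kS -fl_pi_j add0r. Qed.

Definition flabby_emb : psh_hom M (psh_of flabby_complex) :=
  @PshHom X M (psh_of flabby_complex) fl_j fl_j_comm.

(** The kernel of [eta] is locally zero, and so is that of its pushout along [fl_e]: a relation
    [fl_glue p = (0, s)] forces [eta p = 0], hence [s = - fl_e p] is locally zero. *)
Lemma flabby_emb_injective : locally_injective flabby_emb.
Proof.
move=> n U s; rewrite [flabby_emb n U s]fl_jE => /eta_eq0 loc x /loc.
move=> [V [VU [Vx]]]; rewrite -hom_nat => ks0.
case: n s {loc} ks0 => [|n] s ks0; first by exists V, VU.
have /fl_pi_eq0[p] := ks0; rewrite fl_glueE => -[/eta_eq0/(_ x Vx) + pE].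
move=> [W [WV [Wx p0]]]; exists W, (subset_trans WV VU); split=> //.
by rewrite -(res_comp VU WV) -pE raddfN -hom_nat p0 !raddf0.
Qed.

Context (S : sheaf X) (i : sheaf_hom S (M 0%N)).
Hypothesis resM : psh_resolution i.

Definition flabby_aug : sheaf_hom S (flabby_complex 0%N) :=
  hom_comp (fl_j 0) i.

(** Locally a cycle of [god (flP n)] is [eta p] with [fl_e p = 0]. For [n = 0], exactness of [M]
    puts [p] in the image of [S]. Later, [p] is the class of some [(t', m)] with [m] a cycle,
    locally [m = d m'], and [fl_pi_j] moves [m] into the first component. *)
Lemma flabby_resolution : is_resolution flabby_aug.
Proof.
apply: psh_resolution_sheaf; split.
- move=> U s; rewrite [flabby_aug U s]fl_jE => /eta_eq0 loc.
  apply: (sheaf_locally_eq0 (@sheafP _ S)) => x /loc[V [VU [Vx]]].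
  rewrite -!hom_nat => /(pr_inj resM) s0; by exists V, VU.
- move=> U s; rewrite [LHS](esym (fl_j_comm (i U s))) (pr_d0 resM).
  exact: raddf0.
- move=> n U t; rewrite [pc_d _ _ _ _]fl_dE => /eta_eq0 loc x /loc.
  move=> [V [VU [Vx]]]; rewrite -hom_nat => /fl_pi_eq0[p]; rewrite fl_glueE.
  move=> ge.
  have pt : eta (flP n) V p = res (god (flP n)) VU t := congr1 fst ge.
  have pe : - fl_e n V p = res (M n.+1) VU 0 := congr1 snd ge.
  have {ge pe} e0 : fl_e n V p = 0 by rewrite -[LHS]opprK pe !raddf0.
  case: n t {loc} p pt e0 => [|n] t p pt e0.
    have [W [WV [Wx [s sE]]]] := pr_exact resM e0 Vx.
    exists W, (subset_trans WV VU); split=> //; exists s.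
    rewrite [LHS]fl_jE -[fl_k 0 W _]/(i W s) sE hom_nat pt.
    exact: res_comp.
  have [t' [m pE]] := fl_pi_surj p; rewrite -pE fl_ekS in e0.
  have [W [WV [Wx [m' mE]]]] := pr_exact resM e0 Vx.
  exists W, (subset_trans WV VU); split=> //.
  exists (res (god (flP n)) WV t' + fl_j n W m').
  rewrite [LHS]fl_dE fl_pi_j mE -[RHS](res_comp VU WV) -pt -hom_nat.
  by congr (eta _ _ _); rewrite -pE -hom_nat.
Qed.

End FlabbyTarget.

(** * Pushouts of presheaf resolutions *)

Section Pushout.
Context (X : topologicalType) (A B C : psh_complex X).
Context (f : psh_hom A B) (g : psh_hom A C).
Implicit Types (U V W : opens X).

Definition po_glue n : sheaf_hom (A n) (psh_prod (B n) (C n)) :=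
  hom_pair (f n) (hom_opp (g n)).

Definition po_obj n := psh_coker (po_glue n).

Definition po_pi n : sheaf_hom (psh_prod (B n) (C n)) (po_obj n) :=
  hom_pi (po_glue n).

Lemma po_glueE n U (a : A n U) : po_glue n U a = (f n U a, - g n U a).
Proof. by []. Qed.

Lemma po_pi_eq0 n U c : po_pi n U c = 0 <-> exists a, po_glue n U a = c.
Proof. exact: hom_pi_eq0. Qed.

Lemma po_pi_eq n U c c' : (exists a, po_glue n U a = c - c') ->
  po_pi n U c = po_pi n U c'.
Proof. by move=> ?; apply/hom_pi_eq. Qed.

Lemma po_pi_surj n U (c : po_obj n U) : exists b c', po_pi n U (b, c') = c.
Proof. by have [[b c'] <-] := hom_pi_surj c; exists b, c'. Qed.

Definition po_prod_d n : sheaf_hom (psh_prod (B n) (C n)) (po_obj n.+1) :=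
  hom_comp (po_pi n.+1) (hom_pair (hom_comp (pc_d B n) (hom_fst _ _))
                                 (hom_comp (pc_d C n) (hom_snd _ _))).

Lemma po_d_subproof n U (a : A n U) : po_prod_d n U (po_glue n U a) = 0.
Proof.
apply/po_pi_eq0; exists (pc_d A n U a); rewrite po_glueE !ph_comm.
by congr pair; rewrite /= raddfN.
Qed.

Definition po_d n : sheaf_hom (po_obj n) (po_obj n.+1) :=
  hom_lift (@po_d_subproof n).

Lemma po_dE n U b c : po_d n U (po_pi n U (b, c)) =
  po_pi n.+1 U (pc_d B n U b, pc_d C n U c).
Proof. exact: hom_liftE. Qed.

Lemma po_dd n U (c : po_obj n U) : po_d n.+1 U (po_d n U c) = 0.
Proof.
have [b [c' <-]] := po_pi_surj c; rewrite !po_dE !pc_dd.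
exact: (raddf0 (po_pi n.+2 U)).
Qed.

Definition pushout : psh_complex X := PshComplex po_dd.

Lemma po_inl_comm n U (b : B n U) :
  hom_comp (po_pi n.+1) (hom_inl _ _) U (pc_d B n U b) =
  po_d n U (hom_comp (po_pi n) (hom_inl _ _) U b).
Proof. by apply/esym; rewrite [LHS]po_dE /= raddf0. Qed.

Definition po_inl : psh_hom B pushout :=
  @PshHom X B pushout (fun n => hom_comp (po_pi n) (hom_inl _ _)) po_inl_comm.

Lemma po_inr_comm n U (c : C n U) :
  hom_comp (po_pi n.+1) (hom_inr _ _) U (pc_d C n U c) =
  po_d n U (hom_comp (po_pi n) (hom_inr _ _) U c).
Proof. by apply/esym; rewrite [LHS]po_dE /= raddf0. Qed.

Definition po_inr : psh_hom C pushout :=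
  @PshHom X C pushout (fun n => hom_comp (po_pi n) (hom_inr _ _)) po_inr_comm.

Lemma po_inlE n U b : po_inl n U b = po_pi n U (b, 0).
Proof. by []. Qed.

Lemma po_inrE n U c : po_inr n U c = po_pi n U (0, c).
Proof. by []. Qed.

Lemma po_comm n U (a : A n U) : po_inl n U (f n U a) = po_inr n U (g n U a).
Proof.
rewrite po_inlE po_inrE; apply: po_pi_eq; exists a; rewrite po_glueE.
by congr pair; rewrite /= ?subr0 ?sub0r.
Qed.

Section Universal.
Context (D : psh_complex X) (u : psh_hom B D) (v : psh_hom C D).
Hypothesis uv : forall n U (a : A n U), u n U (f n U a) = v n U (g n U a).

Lemma po_lift_subproof n U (a : A n U) :
  hom_copair (u n) (v n) U (po_glue n U a) = 0.
Proof. by rewrite po_glueE /= /copair_fun /= raddfN uv subrr. Qed.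

Definition po_lift_app n : sheaf_hom (po_obj n) (D n) :=
  hom_lift (@po_lift_subproof n).

Lemma po_lift_appE n U b c :
  po_lift_app n U (po_pi n U (b, c)) = u n U b + v n U c.
Proof. exact: hom_liftE. Qed.

Lemma po_lift_comm n U (c : po_obj n U) :
  po_lift_app n.+1 U (po_d n U c) = pc_d D n U (po_lift_app n U c).
Proof.
have [b [c' <-]] := po_pi_surj c.
by rewrite po_dE !po_lift_appE raddfD !ph_comm.
Qed.

Definition po_lift : psh_hom pushout D :=
  @PshHom X pushout D po_lift_app po_lift_comm.

Lemma po_lift_inl n U b : po_lift n U (po_inl n U b) = u n U b.
Proof. by rewrite [LHS]po_lift_appE raddf0 addr0. Qed.

Lemma po_lift_inr n U c : po_lift n U (po_inr n U c) = v n U c.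
Proof. by rewrite [LHS]po_lift_appE raddf0 add0r. Qed.

End Universal.

Context (S : sheaf X) (iA : sheaf_hom S (A 0%N)) (iB : sheaf_hom S (B 0%N))
  (iC : sheaf_hom S (C 0%N)).
Hypothesis resA : psh_resolution iA.
Hypothesis resB : psh_resolution iB.
Hypothesis resC : psh_resolution iC.
Hypothesis fi : forall U (s : S U), f 0%N U (iA U s) = iB U s.
Hypothesis gi : forall U (s : S U), g 0%N U (iA U s) = iC U s.
Hypothesis finj : locally_injective f.

Definition po_aug : sheaf_hom S (pushout 0%N) := hom_comp (po_inl 0%N) iB.

(** In degree 0 the augmentations of [B] and [C] become equal in the pushout, through [iA], so the
    two sections of [S] simply add up. *)
Lemma po_aug_bd n U (b : B n U) (c : C n U) :
  aug_bd iB b -> aug_bd iC c -> aug_bd po_aug (po_pi n U (b, c)).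
Proof.
case: n b c => [|n] b c; last first.
  by move=> [b' <-] [c' <-]; exists (po_pi n U (b', c')); rewrite [LHS]po_dE.
move=> [s <-] [s' <-]; exists (s + s').
rewrite [LHS]po_inlE; apply: po_pi_eq; exists (iA U s').
by rewrite po_glueE fi gi; congr pair; rewrite /= ?sub0r// raddfD addrC addKr.
Qed.

(** A representative [(b, c')] of a cycle satisfies [d b = f a] and [d c' = - g a]. Local
    injectivity of [f] makes [a] a cycle near each point, so locally [a = d a'], and
    [(b - f a', c' + g a')] represents the same class by a pair of cycles. *)
Lemma pushout_resolution : psh_resolution po_aug.
Proof.
split.
- move=> U s; rewrite [po_aug U s]po_inlE => /po_pi_eq0[a].
  rewrite po_glueE => -[fa gaN].
  have ga : g 0%N U a = 0 by rewrite -[LHS]opprK gaN oppr0.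
  have /finj loc : f 0%N U (a - iA U s) = 0 by rewrite raddfB fa fi subrr.
  apply: (sheaf_locally_eq0 (@sheafP _ S)) => x /loc[V [VU [Vx as0]]].
  exists V, VU; split=> //; apply: (pr_inj resC); rewrite -gi hom_nat.
  have <- : res (A 0%N) VU a = res (A 0%N) VU (iA U s).
    by apply/eqP; rewrite -subr_eq0 -raddfB as0.
  by rewrite hom_nat ga raddf0.
- move=> U s; rewrite [pc_d _ _ _ _]po_dE (pr_d0 resB) raddf0.
  exact: (raddf0 (po_pi 1 U)).
- move=> n U c; have [b [c' <-]] := po_pi_surj c.
  rewrite [pc_d _ _ _ _]po_dE => /po_pi_eq0[a]; rewrite po_glueE => -[fa ga] x Ux.
  have /finj/(_ x Ux)[V [VU [Vx da0]]] : f n.+2 U (pc_d A n.+1 U a) = 0.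
    by rewrite ph_comm fa pc_dd.
  rewrite -hom_nat in da0.
  have [W [WV [Wx [a' aE]]]] := pr_exact resA da0 Vx.
  have WU := subset_trans WV VU; rewrite (res_comp _ _ WU) in aE.
  pose b1 := res (B n) WU b - f n W a'.
  pose c1 := res (C n) WU c' + g n W a'.
  have db1 : pc_d B n W b1 = 0.
    by rewrite raddfB hom_nat -fa -ph_comm aE hom_nat subrr.
  have dc1 : pc_d C n W c1 = 0.
    by rewrite raddfD hom_nat -ga -ph_comm aE raddfN -hom_nat addNr.
  have [W1 [W1W [W1x bd1]]] := pr_exact resB db1 Wx.
  have dc1' : pc_d C n W1 (res (C n) W1W c1) = 0 by rewrite hom_nat dc1 raddf0.
  have [W2 [W2W1 [W2x bd2]]] := pr_exact resC dc1' W1x.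
  have {}bd1 := aug_bd_res W2W1 bd1.
  have W2U := subset_trans W2W1 (subset_trans W1W WU).
  have W2W := subset_trans W2W1 W1W.
  rewrite !(res_comp _ _ W2W) in bd1 bd2.
  exists W2, W2U; split=> //.
  have -> : res (po_obj n) W2U (po_pi n U (b, c')) =
      po_pi n W2 (res (B n) W2W b1, res (C n) W2W c1).
    rewrite -(hom_nat (po_pi n)); apply: po_pi_eq.
    exists (res (A n) W2W a'); rewrite po_glueE !hom_nat.
    congr pair => /=.
      rewrite /b1 (raddfB (res (B n) W2W)) (res_comp _ _ W2U).
      by rewrite opprB addrC subrK.
    rewrite /c1 (raddfD (res (C n) W2W)) (res_comp _ _ W2U).
    by rewrite opprD addrA subrr sub0r.
  exact: po_aug_bd.
Qed.

End Pushout.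

(** * A common flabby target of two resolutions *)

Section CommonTarget.
Context (X : topologicalType) (S : sheaf X).
Implicit Types (U V W : opens X).

(** [S] in degree 0 is a resolution of itself, so a pushout under [S] is an instance of the pushout
    of resolutions. *)
Definition conc_obj n : presheaf X :=
  match n with 0 => S | _.+1 => psh_zero X end.

Lemma conc_dd n U (s : conc_obj n U) :
  hom_zero (conc_obj n.+1) (conc_obj n.+2) U
    (hom_zero (conc_obj n) (conc_obj n.+1) U s) = 0.
Proof. by []. Qed.

Definition concentrated : psh_complex X := PshComplex conc_dd.

Definition conc_aug : sheaf_hom S (concentrated 0%N) := hom_id S.

Lemma concentrated_resolution : psh_resolution conc_aug.
Proof.
split=> [U s //|U s //|n U s _ x Ux]; exists U, (@subset_refl _ _); split=> //.
case: n s => [|n] s; first by exists s; rewrite res_id.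
by exists 0; exact: psh_zero_eq.
Qed.

Section FromConc.
Context (M : psh_complex X) (i : sheaf_hom S (M 0%N)).
Hypothesis resM : psh_resolution i.

Definition conc_hom_app n : sheaf_hom (concentrated n) (M n) :=
  match n return sheaf_hom (concentrated n) (M n) with
  | 0 => i
  | m.+1 => hom_zero (psh_zero X) (M m.+1)
  end.

Lemma conc_hom_comm n U (s : concentrated n U) :
  conc_hom_app n.+1 U (pc_d concentrated n U s) = pc_d M n U (conc_hom_app n U s).
Proof.
by case: n s => [|n] s /=; [rewrite (pr_d0 resM)|rewrite raddf0].
Qed.

Definition conc_hom : psh_hom concentrated M :=
  @PshHom X concentrated M conc_hom_app conc_hom_comm.

Lemma conc_hom_injective : locally_injective conc_hom.
Proof.
move=> [|n] U s s0 x Ux; exists U, (@subset_refl _ _); split=> //.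
  by rewrite (pr_inj resM s0) raddf0.
exact: psh_zero_eq.
Qed.

End FromConc.

Context (K F : sheaf_complex X) (iK : sheaf_hom S (K 0%N)) (iF : sheaf_hom S (F 0%N)).
Hypothesis resK : is_resolution iK.
Hypothesis resF : is_resolution iF.

Lemma common_flabby_target :
  exists (L : sheaf_complex X) (iL : sheaf_hom S (L 0%N))
    (a : complex_hom K L) (b : complex_hom F L),
  [/\ is_resolution iL, forall n, flabby (L n),
      resolution_hom iK iL a, resolution_hom iF iL b
    & forall (L' : sheaf_complex X) (iL' : sheaf_hom S (L' 0%N))
        (a' : complex_hom K L') (b' : complex_hom F L'),
      is_resolution iL' -> resolution_hom iK iL' a' -> resolution_hom iF iL' b' ->
      exists (P : sheaf_complex X) (iP : sheaf_hom S (P 0%N))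
        (c : complex_hom L P) (c' : complex_hom L' P),
      [/\ is_resolution iP, forall n, flabby (P n),
          resolution_hom iL' iP c',
          forall n U (k : K n U), c n U (a n U k) = c' n U (a' n U k)
        & forall n U (k : F n U), c n U (b n U k) = c' n U (b' n U k)]].
Proof.
have rK := resolution_psh resK; have rF := resolution_psh resF.
have rS := concentrated_resolution.
pose f := conc_hom rK; pose g := conc_hom rF.
have finj : locally_injective f by exact: conc_hom_injective.
have rM := pushout_resolution rS rK rF (f := f) (g := g)
  (fun U s => erefl) (fun U s => erefl) finj.
set M := pushout f g in rM.
pose L := flabby_complex M; pose j := flabby_emb M.
pose u : psh_hom (psh_of K) M := po_inl f g.
pose v : psh_hom (psh_of F) M := po_inr f g.
have vF U (s : S U) : v 0%N U (iF U s) = po_aug f g iK U s.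
  exact/esym/(po_comm f g (s : concentrated 0%N U)).
exists L, (flabby_aug (po_aug f g iK)).
exists (to_complex_hom (ph_comp j u)), (to_complex_hom (ph_comp j v)); split.
- exact: flabby_resolution.
- exact: flabby_complex_flabby.
- by [].
- by move=> U s; exact: (congr1 (j 0%N U) (vF U s)).
move=> L' iL' a' b' resL' ia' ib'; have rL' := resolution_psh resL'.
have uv n U (s : concentrated n U) :
    psh_hom_of a' n U (f n U s) = psh_hom_of b' n U (g n U s).
  by case: n s => [|n] s /=; [rewrite ia' ib'|rewrite !raddf0].
pose w : psh_hom M (psh_of L') := po_lift uv.
have w0 U (s : S U) : w 0%N U (po_aug f g iK U s) = iL' U s.
  by rewrite [LHS](po_lift_inl uv) [LHS]ia'.
have rL := resolution_psh (flabby_resolution rM).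
(* Local injectivity of the embedding [j] makes the second pushout, of [L] and [L'] under [M], a
   resolution, whatever [w] is. *)
have rM2 := pushout_resolution rM rL rL' (f := j) (g := w) (fun U s => erefl) w0
  (@flabby_emb_injective _ M).
set M2 := pushout j w in rM2.
pose P := flabby_complex M2; pose j2 := flabby_emb M2.
exists P, (flabby_aug (po_aug j w (flabby_aug (po_aug f g iK)))).
exists (to_complex_hom (ph_comp j2 (po_inl j w))).
exists (to_complex_hom (ph_comp j2 (po_inr j w))); split.
- exact: flabby_resolution.
- exact: flabby_complex_flabby.
- move=> U s; rewrite -w0; congr (j2 0%N U _); exact/esym/(po_comm j w).
- move=> n U k; congr (j2 n U _).
  by rewrite [LHS](po_comm j w) (po_lift_inl uv).
- move=> n U k; congr (j2 n U _).
  by rewrite [LHS](po_comm j w) (po_lift_inr uv).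
Qed.

End CommonTarget.

(** * Cohomology classes and induced maps *)

Section CohomologyClasses.
Context (C : cochain_complex) (q : nat).

Lemma coh_pi_surj (c : cohomology C q) :
  exists x : cocycle C q, c = \pi_(cohomology C q) x.
Proof. by exists (repr c); rewrite reprK. Qed.

Lemma coh_pi_eq (x y : cocycle C q) :
  \pi_(cohomology C q) x = \pi_(cohomology C q) y <->
  is_coboundary (val x - val y).
Proof.
have := Quotient.idealrBE (@coboundary C q : zmodClosed _) x y.
rewrite unfold_in => e; split=> [xy|b].
  by apply/asboolP; rewrite e xy.
by apply/eqP; rewrite -e; apply/asboolP.
Qed.

End CohomologyClasses.

Section CohomologyMaps.
Context (C D : cochain_complex) (f : cochain_map C D) (q : nat).

Lemma cohomology_map_additive : zmod_morphism (@cohomology_map C D f q).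
Proof.
move=> c d; have [[x ->] [y ->]] := (coh_pi_surj c, coh_pi_surj d).
rewrite -raddfB !cohomology_mapE -raddfB; congr (\pi_(_) _).
by apply: val_inj; rewrite /= raddfB.
Qed.

Lemma cohomology_map_bijective :
  (forall x : C q, cc_d C q x = 0 -> is_coboundary (f q x) -> is_coboundary x) ->
  (forall y : D q, cc_d D q y = 0 ->
     exists2 x : C q, cc_d C q x = 0 & is_coboundary (f q x - y)) ->
  bijective (@cohomology_map C D f q).
Proof.
move=> finj fsurj.
have inj : injective (@cohomology_map C D f q).
  move=> c d; have [[x ->] [y ->]] := (coh_pi_surj c, coh_pi_surj d).
  rewrite !cohomology_mapE => /coh_pi_eq /=; rewrite -raddfB => fxy.
  by apply/coh_pi_eq; apply: finj => //; rewrite raddfB !kerP subrr.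
have surj (d : cohomology D q) : exists c, cohomology_map f c = d.
  have [y ->] := coh_pi_surj d; have [x dx fx] := fsurj _ (kerP y).
  exists (\pi_(cohomology C q) (to_ker dx : cocycle C q)).
  by rewrite cohomology_mapE; apply/coh_pi_eq.
exists (fun d => projT1 (cid (surj d))) => [c|d].
  by apply: inj; exact: projT2 (cid (surj _)).
exact: projT2 (cid (surj d)).
Qed.

End CohomologyMaps.

(** * Comparison maps on relative cohomology *)

Section RelativeMaps.
Context (X : topologicalType) (X' : opens X) (S : sheaf X).
Implicit Types (U V W : opens X).

Section Resolutions.
Context (K L : sheaf_complex X).
Context (iK : sheaf_hom S (K 0%N)) (iL : sheaf_hom S (L 0%N)).
Context (a : complex_hom K L).
Hypothesis resK : is_resolution iK.
Hypothesis resL : is_resolution iL.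
Hypothesis ia : resolution_hom iK iL a.
Hypothesis acK : forall n, acyclic (opensT X) (K n).
Hypothesis acK' : forall n, acyclic X' (K n).
Hypothesis flL : forall n, flabby (L n).

Definition prev_res n : prev_sec (opensT X) L n -> prev_sec X' L n :=
  match n with 0 => fun=> tt | m.+1 => res (L m) (@subopensT X X') end.

Lemma prev_d_res n (l : prev_sec (opensT X) L n) :
  prev_d X' L n (prev_res l) = res (L n) (@subopensT X X') (prev_d _ L n l).
Proof. by case: n l => [|n] l /=; rewrite ?raddf0 ?hom_nat. Qed.

Let exT0 := cone_exact0 resK resL ia acK flL.
Let exTS := cone_exactS resK resL ia acK flL.
Let ex0 := cone_exact0 resK resL ia acK' flL.
Let exS := cone_exactS resK resL ia acK' flL.
Local Notation rX := (res _ (@subopensT X X')).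

(** The cone is used twice. Over [X] it gives [k'] with [d k' = k1]; the error [k2] of [k'] on [X']
    is then a cycle that [a] sends to a boundary, and over [X'] the cone gives [k2 = d k3]. The
    primitive is [(k', - k3)]. *)
Lemma relative_map_inj q (x : rel_obj X' K q) : rel_d x = 0 ->
  is_coboundary (C := relative_complex X' L) (rel_hom a x) ->
  is_coboundary (C := relative_complex X' K) x.
Proof.
case: q x => [|p] [k1 k01] [/= dk1 rk1].
  by case=> ak1; congr pair; [exact: exT0|case: k01 {rk1}].
move=> [[l1 l01]] [al1 al01].
have [k' [l' [dk' l1E]]] := exTS dk1 (esym al1).
have {}rk1 : rX k1 = sc_d K p X' k01 by apply/eqP; rewrite -subr_eq0 rk1.
have [k2 k2E] : exists k2 : K p X', k2 = k01 - rX k' by eexists.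
have dk2 : sc_d K p X' k2 = 0 by rewrite k2E raddfB hom_nat dk' rk1 subrr.
have ak2 : a p X' k2 = prev_d X' L p (- (prev_res l' + l01)).
  rewrite (raddfN (prev_d X' L p)) (raddfD (prev_d X' L p)) prev_d_res.
  rewrite k2E (raddfB (a p X')) hom_nat -al01 l1E raddfB addrAC.
  by rewrite [X in X + _]addrAC subrr sub0r opprD.
case: p k01 k' l' l1 l01 k1 k2 dk1 al1 al01 dk' l1E rk1 k2E dk2 ak2
  => [|r] k01 k' l' l1 l01 k1 k2 dk1 al1 al01 dk' l1E rk1 k2E dk2 ak2.
  exists (k', tt); congr pair => //=; rewrite subr0.
  by apply/esym/eqP; rewrite -subr_eq0 -k2E (ex0 dk2 ak2).
have [k3 [l3 [dk3 _]]] := exS dk2 ak2.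
exists (k', - k3); congr pair => //=.
by rewrite raddfN opprK dk3 k2E addrC subrK.
Qed.

(** Over [X] the cone writes [l1] as [a k1 - d l']. Over [X'] the restriction of [k1] has image
    [d (l01 + l')], so it is [d k01] with [l01 + l' = a k01 - d l'']. The coboundary of
    [(l', - l'')] accounts for the difference. *)
Lemma relative_map_surj q (y : rel_obj X' L q) : rel_d y = 0 ->
  exists2 x : rel_obj X' K q, rel_d x = 0 &
    is_coboundary (C := relative_complex X' L) (rel_hom a x - y).
Proof.
case: y => l1 l01 [/= dl1 rl1].
have {}rl1 : rX l1 = prev_d X' L q l01 by apply/eqP; rewrite -subr_eq0 rl1.
have [||k1 [l' [dk1 l1E]]] := @exTS q 0 l1; rewrite ?raddf0 ?dl1//.
have drk1 : sc_d K q X' (rX k1) = 0 by rewrite hom_nat dk1 raddf0.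
have ark1 : a q X' (rX k1) = prev_d X' L q (l01 + prev_res l').
  by rewrite raddfD prev_d_res -rl1 l1E raddfB hom_nat subrK.
case: q l1 l01 k1 l' dl1 rl1 dk1 l1E drk1 ark1
  => [|p] l1 l01 k1 l' dl1 rl1 dk1 l1E drk1 ark1.
  exists (k1, tt); first by congr pair => //=; rewrite subr0; exact: ex0.
  by congr pair; rewrite /= l1E subr0 subrr.
have [k01 [l'' [dk01 l01E]]] := exS drk1 ark1.
exists (k1, k01); first by congr pair => //=; rewrite dk01 subrr.
exists (l', - l''); congr pair => /=; first by rewrite l1E opprB addrC subrK.
have -> : l01 = a p X' k01 - prev_d X' L p l'' - rX l' by rewrite -l01E addrK.
by rewrite raddfN opprK !opprB [RHS]addrCA [X in _ = _ + X]addrC subrK.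
Qed.

Lemma relative_map_bijective q :
  bijective (@cohomology_map _ _ (relative_map X' a) q).
Proof.
by apply: cohomology_map_bijective; [exact: relative_map_inj|exact: relative_map_surj].
Qed.

End Resolutions.

(** Flabbiness makes the restriction to [X'] surjective. Extending the second component of a
    relative cochain to [X] and subtracting the coboundary of the extension leaves a cochain with
    second component zero. *)
Lemma vanishing_to_relative_bijective (F : sheaf_complex X) q :
  (forall n, flabby (F n)) ->
  bijective (@cohomology_map _ _ (vanishing_to_relative X' F) q).
Proof.
move=> flF; apply: cohomology_map_bijective.
  case: q => [|p] x dx /=; first by move=> [x0]; exact: val_inj.
  move=> [[g1 g01]] [dg1 rg1].
  have {}rg1 : res _ (@subopensT X X') g1 = prev_d X' F p g01.
    by apply/eqP; rewrite -subr_eq0 rg1.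
  case: p x dx g1 g01 dg1 rg1 => [|r] x dx g1 g01 dg1 rg1.
    by exists (to_ker rg1); apply: val_inj.
  have [h hE] := flF r X' g01.
  have rg : res _ (@subopensT X X') (g1 - sc_d F r _ h) = 0.
    by rewrite raddfB -hom_nat hE rg1 subrr.
  exists (to_ker rg); apply: val_inj => /=.
  by rewrite raddfB sc_dd subr0.
case: q => [|p] [f1 f01] [/= df1 rf1].
  have {}rf1 : res _ (@subopensT X X') f1 = 0 by rewrite -rf1 subr0.
  exists (to_ker rf1); first exact: val_inj.
  by congr pair; rewrite /= subrr.
have {}rf1 : res _ (@subopensT X X') f1 = sc_d F p X' f01.
  by apply/eqP; rewrite -subr_eq0 rf1.
have [g gE] := flF p X' f01.
have rg : res _ (@subopensT X X') (f1 - sc_d F p _ g) = 0.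
  by rewrite raddfB -hom_nat gE rf1 subrr.
exists (to_ker rg); first by apply: val_inj; rewrite /= raddfB df1 sc_dd subr0.
exists (- g, 0); congr pair => /=.
  by rewrite raddfN addrC addKr.
by rewrite raddf0 subr0 sub0r raddfN gE.
Qed.

End RelativeMaps.

(** * Assembly of the canonical isomorphism *)

Lemma cohomology_map_comp_eq (C D D' E : cochain_complex) (f : cochain_map C D)
    (g : cochain_map D E) (f' : cochain_map C D') (g' : cochain_map D' E) q :
  (forall x : C q, g q (f q x) = g' q (f' q x)) ->
  forall c : cohomology C q, cohomology_map g (cohomology_map f c) =
                             cohomology_map g' (cohomology_map f' c).
Proof.
move=> gf c; have [x ->] := coh_pi_surj c; rewrite !cohomology_mapE.
by congr (\pi_(_) _); apply: val_inj; exact: gf.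
Qed.

Lemma relative_map_comp_eq (X : topologicalType) (X' : opens X)
    (K L L' P : sheaf_complex X) (a : complex_hom K L) (u : complex_hom L P)
    (a' : complex_hom K L') (u' : complex_hom L' P) q :
  (forall n (U : opens X) (k : K n U), u n U (a n U k) = u' n U (a' n U k)) ->
  forall c : relcoh_sections X' K q,
    cohomology_map (relative_map X' u) (cohomology_map (relative_map X' a) c) =
    cohomology_map (relative_map X' u') (cohomology_map (relative_map X' a') c).
Proof.
move=> ua; apply: cohomology_map_comp_eq => -[x1 x01]; congr pair; first exact: ua.
by case: q x1 x01 => [|n] x1 x01 //; exact: ua.
Qed.

Theorem mainTheorem1 (X : topologicalType) (X' : opens X)
    (parX : paracompact X) (parX' : paracompact (set_type X'))
    (S : sheaf X)
    (K : sheaf_complex X) (iK : sheaf_hom S (K 0%N))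
    (resK : is_resolution iK)
    (fineK : forall p : nat, fine (K p))
    (fineK' : forall p : nat, fine (sheaf_restr X' (K p)))
    (F : sheaf_complex X) (iF : sheaf_hom S (F 0%N))
    (resF : is_resolution iF)
    (flabbyF : forall p : nat, flabby (F p))
    (q : nat) :
  exists Phi : {additive relcoh_sections X' K q -> relcoh X' F q},
    [/\ bijective Phi,
        canonical_comparison iK iF Phi
      & forall Psi : relcoh_sections X' K q -> relcoh X' F q,
          canonical_comparison iK iF Psi -> Psi =1 Phi].
Proof.
have acK n := fine_acyclic parX (fineK n).
have acK' n := fine_restr_acyclic parX' (fineK' n).
(* With this, [relative_map_bijective] also applies to morphisms out of flabby resolutions: first
   [F], then each competing [L']. *)
have acF (G : sheaf_complex X) (flG : forall n, flabby (G n)) (Y : opens X) n :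
  acyclic Y (G n) := acyclic_flabby Y (@sheafP _ (G n)) (flG n).
have [L [iL [a [b [resL flL ia ib LP]]]]] := common_flabby_target resK resF.
have bij_a := relative_map_bijective resK resL ia acK acK' flL q.
have bij_b := relative_map_bijective resF resL ib
  (acF F flabbyF _) (acF F flabbyF X') flL q.
have bij_v := vanishing_to_relative_bijective X' q flabbyF.
(* [B] is the side of the canonicity diagram that runs from [relcoh X' F q] to the target built from
   [L]. As it is bijective, [Phi] can only be its inverse composed with the map induced by [a]. *)
pose B (c : relcoh X' F q) : relcoh_sections X' L q :=
  cohomology_map (relative_map X' b) (cohomology_map (vanishing_to_relative X' F) c).
have [B' BK B'K] : bijective B := bij_comp bij_b bij_v.
have BB : zmod_morphism B by move=> x y; rewrite /B !cohomology_map_additive.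
pose phi (c : relcoh_sections X' K q) : relcoh X' F q :=
  B' (cohomology_map (relative_map X' a) c).
have phi_additive : zmod_morphism phi.
  move=> x y; apply: (can_inj BK).
  by rewrite BB /phi !B'K cohomology_map_additive.
pose Phi : {additive relcoh_sections X' K q -> relcoh X' F q} :=
  HB.pack phi (GRing.isZmodMorphism.Build _ _ phi phi_additive).
exists Phi; split.
- by apply: bij_comp bij_a; exists B.
- move=> L' iL' a' b' resL' flL' ia' ib' c.
  have [P [iP [u [u' [resP flP iu' ua ub]]]]] := LP _ _ a' b' resL' ia' ib'.
  have bij_u' := relative_map_bijective resL' resP iu'
    (acF L' flL' _) (acF L' flL' X') flP q.
  (* After [u'] both sides factor through [L], where the identity holds by the choice of [Phi]. *)
  apply: (bij_inj bij_u').
  rewrite -(relative_map_comp_eq ua) -(relative_map_comp_eq ub).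
  by congr (cohomology_map _ _); exact/esym/B'K.
(* The diagram for this single [L] already determines [B (Psi c)]. *)
- move=> Psi PsiP c; apply: (can_inj BK).
  by rewrite [RHS]B'K /B -(PsiP L iL a b).
Qed.
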